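(* Let $n\ge 1$, let $\xi=(\xi_1,\dots,\xi_l)$ be a strict partition of $n$ and let $\mu=(\mu_1,\dots,\mu_m)$ be a partition of $n$. Then $$K^-_{\xi\mu}(t)=\sum_{i=1}^{l}\ \sum_{\tau\models \xi_i-\mu_1}\ \sum_{\lambda\vdash n-\xi_i}(-1)^{i-1}\,2\,t^{\xi_i-\mu_1}(1+t^{-1})^{l(\tau)}\,B(\lambda,\mu^{[1]}-\tau)\,K^-_{\xi^{\hat i}\lambda}(t).$$
   Context: Let $\Lambda_F$ be the ring of symmetric functions over $F=\mathbb{Q}(t)$, with power sums $p_r$ and $p_\lambda=p_{\lambda_1}p_{\lambda_2}\cdots$. For a partition $\lambda$ with $m_i$ parts equal to $i$, $z_\lambda=\prod_i i^{m_i}m_i!$ and $z_\lambda(t)=z_\lambda/\prod_i(1-t^{\lambda_i})$. Equip $\Lambda_F$ with the bilinear form $\langle p_\lambda,p_\mu\rangle=\delta_{\lambda\mu}z_\lambda(t)$. Define operators $H_n$ ($n\in\mathbb{Z}$) on $\Lambda_F$ by $\sum_{n\in\mathbb Z}H_nz^n=\exp\big(\sum_{n\ge1}\frac{1-t^n}{n}p_nz^n\big)\exp\big(-\sum_{n\ge1}\frac{\partial}{\partial p_n}z^{-n}\big)$. For a finite sequence of integers $\nu=(\nu_1,\dots,\nu_r)$ write $H_\nu.1=H_{\nu_1}\cdots H_{\nu_r}.1$; for a partition $\lambda$, $H_\lambda.1=Q_\lambda(x;t)$ is the Hall–Littlewood $Q$-function. $B(\lambda,\nu)$ denotes the straightening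 coefficient defined by $H_\nu.1=\sum_{\lambda\vdash|\nu|}B(\lambda,\nu)Q_\lambda(x;t)$, where $|\nu|=\sum_j\nu_j$ (the paper gives these coefficients by an explicit combinatorial straightening rule, equivalent to this expansion). $P_\mu(x;t)$ is the Hall–Littlewood $P$-function and $Q_\xi(x)$, for $\xi$ strict, is Schur's $Q$-function. The spin Kostka polynomials $K^-_{\xi\mu}(t)$ are defined by $Q_\xi(x)=\sum_\mu K^-_{\xi\mu}(t)P_\mu(x;t)$; by convention $K^-_{\emptyset\emptyset}=1$. Notation: $\mu^{[1]}=(\mu_2,\dots,\mu_m)$; $\xi^{\hat i}=(\xi_1,\dots,\xi_{i-1},\xi_{i+1},\dots,\xi_l)$; $\tau\models k$ means $\tau$ is a composition of $k$ (a finite sequence of positive integers summing to $k$; only the empty composition if $k=0$, none if $k<0$), $l(\tau)$ is its number of parts; $\mu^{[1]}-\tau$ is the componentwise difference $(\mu_2-\tau_1,\mu_3-\tau_2,\dots)$, where the shorter sequence is padded with zeros.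
   Formalization: The sum over τ runs over sequences of n nonnegative integers with sum ξ_i−μ_1 (zero parts allowed), and l(τ) counts the nonzero parts; with positive parts only the formula fails, e.g. for ξ=(2,1), μ=(1,1,1). *)

(* Defs.v *)
From HB Require Import structures.
From mathcomp Require Import all_boot all_order all_algebra.
From mathcomp.multinomials Require Import monalg.
From mathcomp Require Import finmap.
From Stdlib Require Import ClassicalEpsilon.

Set Implicit Arguments.
Unset Strict Implicit.
Unset Printing Implicit Defensive.

Import GRing.Theory Num.Theory.
Local Open Scope ring_scope.

(* A partition, or a composition, is the sequence of its (positive) parts. *)
Definition is_composition (s : seq nat) : bool := all (leq 1) s.
Definition is_partition (s : seq nat) : bool :=
  sorted geq s && is_composition s.
Definition is_strict_partition (s : seq nat) : bool :=
  sorted gtn s && is_composition s.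

(* The sequences of length at most n with entries at most n: a finite set that
   contains all compositions of n. *)
Definition bounded_seqs (n : nat) : seq (seq nat) :=
  [seq map val (val s) | s <- enum {bseq n of 'I_n.+1}].

(* The arguments are integers: there are no compositions or partitions of a
   negative number. *)
Definition compositions (k : int) : seq (seq nat) :=
  if k is Posz n then
    [seq s <- bounded_seqs n | is_composition s && (sumn s == n)]
  else [::].

Definition partitions (k : int) : seq (seq nat) :=
  [seq s <- compositions k | is_partition s].

Lemma uniq_bounded_seqs n : uniq (bounded_seqs n).
Proof.
rewrite map_inj_uniq ?enum_uniq // => x y exy.
by apply/val_inj/(inj_map val_inj).
Qed.

Lemma mem_le_sumn a s : a \in s -> (a <= sumn s)%N.
Proof.
elim: s => //= b r IH; rewrite inE => /predU1P[->|/IH]; first exact: leq_addr.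
by move/leq_trans; apply; exact: leq_addl.
Qed.

Lemma size_le_sumn s : is_composition s -> (size s <= sumn s)%N.
Proof. by elim: s => //= a s IH /andP[a0 /IH]; rewrite -add1n; exact: leq_add. Qed.

Lemma mem_compositions (k : int) s :
  (s \in compositions k) = is_composition s && ((sumn s)%:Z == k).
Proof.
case: k => [n|n]; last by rewrite /= andbF.
rewrite /= mem_filter eqz_nat; case: (boolP (is_composition s)) => //= cs.
case: eqP => //= sn; apply/mapP.
have szs : (size (map (@inord n) s) <= n)%N.
  by rewrite size_map -sn size_le_sumn.
exists (Bseq szs); first by rewrite mem_enum.
rewrite /= -map_comp -[LHS]map_id; apply/eq_in_map => a /mem_le_sumn an /=.
by rewrite inordK // ltnS -sn.
Qed.

Lemma uniq_compositions k : uniq (compositions k).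
Proof. by case: k => // n; rewrite filter_uniq ?uniq_bounded_seqs. Qed.

Lemma mem_partitions (k : int) s :
  (s \in partitions k) = is_partition s && ((sumn s)%:Z == k).
Proof.
by rewrite mem_filter mem_compositions /is_partition; case: (is_composition s);
  rewrite ?andbT ?andbF.
Qed.

Lemma uniq_partitions k : uniq (partitions k).
Proof. by rewrite filter_uniq ?uniq_compositions. Qed.

(* The sequences of r natural numbers, zeros allowed, with sum k; a composition
   of k with at most r parts is in the list, padded with zeros.  The recursion
   for the spin Kostka polynomials needs zeros at any position: for
   xi = (2,1) and mu = (1,1,1) it must distribute 1 over mu_2, mu_3 both as
   (1,0) and as (0,1), and with (1,0) alone it fails. *)
Definition weak_compositions (r : nat) (k : int) : seq (seq nat) :=
  if k is Posz n then
    [seq s <- [seq map val (val s) | s <- enum {: r.-tuple 'I_n.+1}]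
       | sumn s == n]
  else [::].

(* The number of parts of the underlying composition. *)
Definition nb_nonzero (s : seq nat) : nat := count (leq 1) s.

Lemma mem_weak_compositions r (k : int) s :
  (s \in weak_compositions r k) = (size s == r) && ((sumn s)%:Z == k).
Proof.
case: k => [n|n]; last by rewrite /= andbF.
rewrite /= mem_filter eqz_nat andbC; case: eqP => [sn|]; last by rewrite !andbF.
rewrite !andbT; apply/mapP/eqP => [[x _ ->]|sr]; first by rewrite size_map size_tuple.
have szs : size (map (@inord n) s) == r by rewrite size_map sr.
exists (Tuple szs); first by rewrite mem_enum.
rewrite /= -map_comp -[LHS]map_id; apply/eq_in_map => a /mem_le_sumn an /=.
by rewrite inordK // ltnS -sn.
Qed.

Lemma uniq_weak_compositions r k : uniq (weak_compositions r k).
Proof.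
case: k => // n; rewrite filter_uniq // map_inj_uniq ?enum_uniq // => x y exy.
by apply/val_inj/(inj_map val_inj).
Qed.

(* F = Q(t). *)
Definition F : fieldType := {fraction {poly rat}}.
Definition t : F := tofrac ('X : {poly rat}).

(* The ring of symmetric functions over F, as the polynomial ring
   F[p_1, p_2, ...]; the variable of index i : nat is p_{i+1}. *)
Definition Lam := {malg F[{cmonom nat}]}.
HB.instance Definition _ := GRing.ComAlgebra.on Lam.

(* The power sum p_r, for r >= 1. *)
Definition psum (r : nat) : Lam := << 1 *g ucm r.-1 >>.

(* The partial derivative with respect to p_r, for r >= 1. *)
Definition pderiv (r : nat) (f : Lam) : Lam :=
  \sum_(m <- msupp f) << f@_m *+ m r.-1 *g divcm m (ucm r.-1) >>.

(* The degree for the grading in which p_r has degree r. *)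
Definition mon_deg (m : {cmonom nat}) : nat :=
  (\sum_(i <- finsupp m) m i * i.+1)%N.
Definition deg (f : Lam) : nat := \max_(m <- msupp f) mon_deg m.

(* The coefficient of z^k in exp(\sum_(n >= 1) a_n z^n), where the a_n are
   operators on Lam.  The coefficient of z^k in (\sum_n a_n z^n)^r is the sum
   of the products a_{tau_1} ... a_{tau_r} over the compositions tau of k into
   r parts. *)
Definition exp_coef (a : nat -> Lam -> Lam) (k : int) (f : Lam) : Lam :=
  \sum_(tau <- compositions k) ((size tau)`!%:R : F)^-1 *: foldr a f tau.

Definition create_op (u : F) (n : nat) (f : Lam) : Lam :=
  ((1 - u ^+ n) / n%:R) *: (psum n * f).

Definition annihil_op (n : nat) (f : Lam) : Lam := - pderiv n f.

Lemma mon_degE (d : {fset nat}) (m : {cmonom nat}) :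
  fsubset (finsupp m) d -> mon_deg m = (\sum_(i <- d) m i * i.+1)%N.
Proof.
move=> le; rewrite /mon_deg (big_fset_incl _ le) //.
by move=> i _; rewrite -cmE_neq0 negbK => /eqP ->.
Qed.

Lemma mon_degM (m1 m2 : {cmonom nat}) :
  mon_deg (mulcm m1 m2) = (mon_deg m1 + mon_deg m2)%N.
Proof.
rewrite [LHS](@mon_degE (fsetU (finsupp m1) (finsupp m2))); last first.
  by rewrite -(mdomD m1 m2).
rewrite (mon_degE (fsubsetUl _ (finsupp m2))).
rewrite (mon_degE (fsubsetUr (finsupp m1) _)).
by rewrite -big_split /=; apply/eq_bigr => i _; rewrite mulcmE mulnDl.
Qed.

Lemma mon_degU r : (0 < r)%N -> mon_deg (ucm r.-1) = r.
Proof. by case: r => // r _; rewrite /mon_deg mdomU big_seq_fset1 cmUU mul1n. Qed.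

Lemma msupp_annihil_op r (g : Lam) e d : (0 < r)%N ->
  {in msupp g, forall m, (mon_deg m + e <= d)%N} ->
  {in msupp (annihil_op r g), forall m, (mon_deg m + (r + e) <= d)%N}.
Proof.
move=> r0 Hg m'; rewrite /annihil_op msuppN /pderiv => m'in.
have [m [min m'm mr]] : exists m,
    [/\ m \in msupp g, m' = divcm m (ucm r.-1) & m r.-1 != 0%N].
  case: (boolP (has (fun m => (m' == divcm m (ucm r.-1)) && (m r.-1 != 0%N))
                    (msupp g))) => [/hasP[m ? /andP[/eqP]]|/hasPn noex].
    by exists m.
  move: m'in; rewrite -mcoeff_neq0 raddf_sum /= big_seq big1 ?eqxx // => m min.
  rewrite mcoeffU; case: eqVneq => [E|]; last by rewrite mulr0n.
  have := noex m min; rewrite E eqxx /= negbK => /eqP ->.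
  by rewrite mulr0n mul0rn.
have mE : m = mulcm m' (ucm r.-1).
  apply/eqP/cmP => i; rewrite m'm mulcmE divcmE ucmE subnK //.
  by case: eqP => // <-; rewrite lt0n.
by have := Hg _ min; rewrite mE mon_degM mon_degU // addnA.
Qed.

Lemma annihil_gt_deg (f : Lam) (j : int) :
  (deg f)%:Z < j -> exp_coef annihil_op j f = 0.
Proof.
move=> degj; rewrite /exp_coef big_seq big1 // => tau.
rewrite mem_compositions => /andP[ctau /eqP stau].
suff -> : foldr annihil_op f tau = 0 by rewrite scaler0.
have lt_deg : (deg f < sumn tau)%N by rewrite -ltz_nat stau.
have H : {in msupp (foldr annihil_op f tau),
    forall m, (mon_deg m + sumn tau <= deg f)%N}.
  elim: tau {stau lt_deg} ctau => [_|r tau IH /andP[r0 /IH H]] /=.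
    by move=> m min; rewrite addn0 /deg; exact: leq_bigmax_seq.
  exact: msupp_annihil_op.
apply/malgP => m; rewrite mcoeff0; apply: contraTeq lt_deg.
by rewrite mcoeff_neq0 -leqNgt => /H; apply/leq_trans; exact: leq_addl.
Qed.

(* The operator H_n with the parameter t specialized to u.  The sum over the
   powers z^{-j} taken from the second exponential is finite on each f, see
   [annihil_gt_deg]. *)
Definition vertex_op (u : F) (n : int) (f : Lam) : Lam :=
  \sum_(j < (deg f).+1)
    exp_coef (create_op u) (n + j%:Z) (exp_coef annihil_op j%:Z f).

(* H_nu.1 *)
Definition vertex_seq (u : F) (nu : seq int) : Lam := foldr (vertex_op u) 1 nu.

Definition HLQ (la : seq nat) : Lam := vertex_seq t [seq a%:Z | a <- la].

Definition HLb (la : seq nat) : F :=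
  \prod_(i <- undup la) \prod_(1 <= j < (count_mem i la).+1) (1 - t ^+ j).

(* P_la(x;t), from Q_la(x;t) = b_la(t) P_la(x;t). *)
Definition HLP (la : seq nat) : Lam := (HLb la)^-1 *: HLQ la.

(* Schur's Q-function is Q_xi(x) = Q_xi(x;-1). *)
Definition schurQ (xi : seq nat) : Lam := vertex_seq (-1) [seq a%:Z | a <- xi].

(* The coefficients, as a function of la |- k, of the expansion of f in the
   family b_la. *)
Definition coefs (b : seq nat -> Lam) (k : int) (f : Lam) : seq nat -> F :=
  epsilon (inhabits (fun=> 0))
    (fun c => f = \sum_(la <- partitions k) c la *: b la).

Definition straight_coef (la : seq nat) (nu : seq int) : F :=
  coefs HLQ (\sum_(a <- nu) a) (vertex_seq t nu) la.

Definition spin_kostka (xi mu : seq nat) : F :=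
  coefs HLP (sumn xi) (schurQ xi) mu.

(* Componentwise difference, the shorter sequence being padded with zeros. *)
Definition padded_sub (s r : seq nat) : seq int :=
  mkseq (fun j => (nth 0%N s j)%:Z - (nth 0%N r j)%:Z) (maxn (size s) (size r)).

Definition del_nth (i : nat) (s : seq nat) : seq nat := take i s ++ drop i.+1 s.

(* Main.v *)
(* Write [X(z) = x(z) D(1/z)] for the vertex operators, where [x(z)] is the
   exponential of the power sums and [D(y)] that of [-d/dp_n], and let [E] be the
   inverse of [D].  Then [x_c = \sum_j X_{c+j} E_j] and
   [E_k X_b = u X_b E_k + (1 - u) x_{b-k} - (1 - u) \sum_{i>0} X_{b+i} E_{k+i}].
   For [u = t] this gives the orthogonality of the [H_la.1], so that
   [K_{xi mu} = <T_xi.1, H_mu.1>] with [T] the operators at [u = -1]; by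
   orthogonality and a dimension count the [H_la.1] are a basis.  For [u = -1] an induction on the
   length of [xi] gives, for [k > 0],
   [E_k T_xi.1 = 2 \sum_i (-1)^(i-1) s_{xi_i-k} T_{xi without xi_i}.1], with [s]
   the exponential at [u = -1].  The adjoint of [H(z)] is
   [q(1/z)^-1 E(z)], so applying it to [T_xi.1] replaces [s] by
   [g = s/q], and moving [g] to the other side of the form across [H_{mu_2} H_{mu_3}...]
   produces the sum over [tau], because
   [(1 + z w)/(1 - t z w) = \sum_k t^k (1 + 1/t)^[k > 0] (z w)^k]. *)
From HB Require Import structures.
From mathcomp Require Import all_boot all_order all_algebra.
From mathcomp.multinomials Require Import monalg.
From mathcomp Require Import finmap.
From mathcomp Require Import zify ring.
From Stdlib Require Import ClassicalEpsilon.
Require Import Defs.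
Set Implicit Arguments.
Unset Strict Implicit.
Unset Printing Implicit Defensive.

Import Order.TTheory GRing.Theory Num.Theory.
Local Open Scope ring_scope.

Lemma scalerCA (R : comPzRingType) (V : lmodType R) (a b : R) (v : V) :
  a *: (b *: v) = b *: (a *: v).
Proof. by rewrite !scalerA mulrC. Qed.

Lemma geq_trans : transitive geq.
Proof. by move=> x y z /= h1 h2; exact: leq_trans h1. Qed.

(** * Sums over sequences, split by the first entry *)

Section BigCons.
Context (V : nmodType).

(** The map [h] is the successor for compositions, whose parts are positive, and the identity for
    weak compositions. Being injective, it makes the pairs [(r, s)] correspond one to one to [A]. *)
Lemma big_seq_cons (A : seq (seq nat)) (h : nat -> nat) (K : nat)
    (B : nat -> seq (seq nat)) (G : seq nat -> V) :
  injective h -> uniq A -> (forall r, uniq (B r)) ->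
  (forall r s, (h r :: s \in A) = (r < K)%N && (s \in B r)) ->
  (forall s, s \in A -> exists r s', s = h r :: s') ->
  \sum_(s <- A) G s = \sum_(r < K) \sum_(s <- B r) G (h r :: s).
Proof.
move=> hI uA uB AB Acons.
rewrite -(big_mkord xpredT (fun r => \sum_(s <- B r) G (h r :: s))) /index_iota subn0.
rewrite -(@big_allpairs_dep _ _ _ _ _ _ (fun r s => h r :: s) (iota 0 K) B G).
apply/perm_big/uniq_perm => //.
  apply: allpairs_uniq_dep; rewrite ?iota_uniq //.
  move=> [r1 s1] [r2 s2] _ _ /= [/hI e1 e2].
  by rewrite e1 in s1 e2 *; rewrite e2.
move=> s; apply/idP/allpairsPdep => [sA|[r [s' [+ + ->]]]]; last first.
  by rewrite mem_iota AB => /= ->.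
have [r [s' e]] := Acons _ sA; move: sA; rewrite e AB => /andP[rK sB].
by exists r, s'; rewrite mem_iota.
Qed.

End BigCons.

Lemma weak_compositions0 (k : int) : weak_compositions 0 k = if k == 0 then [:: [::]] else [::].
Proof.
case: eqVneq => [->|k0].
  apply: perm_small_eq => //; apply: uniq_perm => //; first exact: uniq_weak_compositions.
  by move=> [|x s]; rewrite mem_weak_compositions.
case E : (weak_compositions 0 k) => [//|s r].
have := mem_head s r; rewrite -E mem_weak_compositions => /andP[/eqP/size0nil ->] /=.
by rewrite eq_sym (negPf k0).
Qed.

Lemma weak_compositionsS (V : nmodType) (l : nat) (k : int) M (G : seq nat -> V) : k < M%:Z ->
  \sum_(s <- weak_compositions l.+1 k) G s =
  \sum_(r < M) \sum_(s <- weak_compositions l (k - r%:Z)) G (nat_of_ord r :: s).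
Proof.
move=> kM; rewrite (@big_seq_cons _ _ id M (fun r => weak_compositions l (k - r%:Z))) //.
- exact: uniq_weak_compositions.
- by move=> r; exact: uniq_weak_compositions.
- move=> r s; rewrite !mem_weak_compositions /= eqSS.
  have -> : ((r + sumn s)%N%:Z == k) = ((sumn s)%:Z == k - r%:Z) by lia.
  by case: (_ == l) => //=; rewrite ?andbF //; case: eqP => /=; rewrite ?andbF // andbT; lia.
- by move=> [|r s]; rewrite mem_weak_compositions //= => _; exists r, s.
Qed.

(** * Exponentials of commuting operators *)

Section ExpCoef.
Context (K : fieldType) (char0 : forall n, n.+1%:R != 0 :> K) (L : lmodType K).
Implicit Types (a b : nat -> {linear L -> L}) (f g : L) (k : int).

Lemma scale_int_inj (V : lmodType K) k (x y : V) :
  k != 0 -> k%:~R *: x = k%:~R *: y -> x = y.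
Proof.
move=> k0; apply: scalerI; case: k k0 => [[|n]|n] // _; first exact: char0.
by rewrite NegzE mulrNz oppr_eq0 -pmulrn char0.
Qed.

(* Convertible to [exp_coef] when [L] is [Lam]. *)
Definition gexp (a : nat -> L -> L) k f : L :=
  \sum_(tau <- compositions k) ((size tau)`!%:R : K)^-1 *: foldr a f tau.

(** The coefficient of [z^k] in [(\sum_r a_r z^r)^l]. *)
Definition len_coef (a : nat -> L -> L) (l : nat) (k : int) (f : L) : L :=
  \sum_(tau <- compositions k | size tau == l) foldr a f tau.

Lemma gexp_len (a : nat -> L -> L) k f N : k < N%:Z ->
  gexp a k f = \sum_(l < N) (l`!%:R : K)^-1 *: len_coef a l k f.
Proof.
move=> kN; rewrite /gexp /len_coef.
under [RHS]eq_bigr => l _ do rewrite scaler_sumr big_mkcond /=.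
rewrite exchange_big /= big_seq [RHS]big_seq; apply: eq_bigr => tau.
rewrite mem_compositions => /andP[/size_le_sumn st /eqP tk].
have sN : (size tau < N)%N by rewrite -ltz_nat (le_lt_trans _ kN) // -tk lez_nat.
rewrite (bigD1 (Ordinal sN)) //= eqxx big1 ?addr0 // => i iN.
by case: eqP => // e; case/eqP: iN; apply/val_inj.
Qed.

Lemma gexp_neg (a : nat -> L -> L) k f : k < 0 -> gexp a k f = 0.
Proof. by case: k => // n _; rewrite /gexp big_nil. Qed.

Lemma compositions0 : compositions 0 = [:: [::]].
Proof.
apply: perm_small_eq => //; apply: uniq_perm => //; first exact: uniq_compositions.
move=> [|[|x] s]; rewrite mem_compositions //=.
by rewrite andbC.
Qed.

Lemma len_coef0 (a : nat -> L -> L) k f :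
  len_coef a 0 k f = if k == 0 then f else 0.
Proof.
rewrite /len_coef; case: eqVneq => [->|k0].
  by rewrite compositions0 big_cons big_nil addr0.
rewrite big_seq_cond big_pred0 // => -[|x s]; rewrite mem_compositions ?andbF //.
by rewrite /= eq_sym (negPf k0).
Qed.

Lemma len_coefS a l k f (M : nat) : k <= M%:Z ->
  len_coef a l.+1 k f = \sum_(r < M) a r.+1 (len_coef a l (k - r.+1%:Z) f).
Proof.
move=> kM; rewrite /len_coef -big_filter.
rewrite (@big_seq_cons _ _ succn M
  (fun r => [seq s <- compositions (k - r.+1%:Z) | size s == l])).
- by apply: eq_bigr => r _; rewrite big_filter linear_sum.
- exact: succn_inj.
- by rewrite filter_uniq ?uniq_compositions.
- by move=> r; rewrite filter_uniq ?uniq_compositions.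
- move=> r s; rewrite !mem_filter !mem_compositions /= eqSS.
  have -> : ((r.+1 + sumn s)%N%:Z == k) = ((sumn s)%:Z == k - r.+1%:Z) by lia.
  case: (_ == l) => //=; case: (is_composition s) => //=; rewrite ?andbF //.
  by case: eqP => /=; rewrite ?andbF // andbT; lia.
- move=> [|r s]; rewrite mem_filter mem_compositions //= => /andP[_ /andP[/andP[r0 _] _]].
  by exists r.-1, s; rewrite prednK.
Qed.

Lemma foldr_comm (a : nat -> L -> L) (c : L -> L) tau f :
  (forall r g, c (a r g) = a r (c g)) -> c (foldr a f tau) = foldr a (c f) tau.
Proof. by move=> ca; elim: tau => //= r s <-; rewrite ca. Qed.

Lemma gexp_comm (a : nat -> L -> L) (c : {linear L -> L}) k f :
  (forall r g, c (a r g) = a r (c g)) -> c (gexp a k f) = gexp a k (c f).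
Proof.
move=> ca; rewrite /gexp linear_sum; apply: eq_bigr => tau _.
by rewrite linearZ /= (foldr_comm _ _ ca).
Qed.

Lemma gexp_is_linear a k : linear (gexp (fun r => a r) k).
Proof.
move=> c f g; rewrite /gexp scaler_sumr -big_split /=; apply: eq_bigr => tau _.
rewrite scalerCA -scalerDr; congr (_ *: _).
by elim: tau => //= r s ->; rewrite linearP.
Qed.

(** With [S(z) = \sum_r a_r z^r] this is [z d/dz S^(l+1) = (l+1) (z dS/dz) S^l], which rests on the
    commutation of the [a_r]. *)
Lemma len_coef_rec a l k f (M : nat) :
  (forall r s g, a r (a s g) = a s (a r g)) -> k <= M%:Z ->
  k%:~R *: len_coef a l.+1 k f =
  l.+1%:R *: \sum_(r < M) r.+1%:R *: a r.+1 (len_coef a l (k - r.+1%:Z) f).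
Proof.
move=> aC; elim: l k => [|l IH] k kM.
  rewrite (len_coefS _ _ _ kM) scale1r scaler_sumr; apply: eq_bigr => r _.
  rewrite len_coef0 subr_eq0; case: eqP => [->|_]; first by rewrite -pmulrn.
  by rewrite linear0 !scaler0.
rewrite (len_coefS _ _ _ kM) scaler_sumr.
(* Here [k] is split as [(k - r.+1) + r.+1]: the induction hypothesis handles the first summand, and
   the second gives the one missing copy of the sum. *)
under eq_bigr => r _.
  rewrite -{1}(subrK r.+1%:Z k) rmorphD /= scalerDl -linearZ /= (IH _ (_ : _ <= M%:Z)); last by lia.
  rewrite linearZ linear_sum /= -pmulrn.
  under eq_bigr => s _ do rewrite linearZ /= aC.
  over.
rewrite big_split /= -scaler_sumr exchange_big /= -[l.+2%:R]natr1 scalerDl.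
rewrite scale1r; congr (_ *: _ + _); apply: eq_bigr => s _.
rewrite -scaler_sumr -linear_sum /=; congr (_ *: a _ _).
rewrite (@len_coefS _ _ _ _ M); last by lia.
apply: eq_bigr => r _; congr (a _ (len_coef _ _ _ _)); by rewrite addrAC.
Qed.

(* [k A_k = \sum_r r a_r A_{k-r}]: the logarithmic derivative of
   [A(z) = exp(\sum_r a_r z^r)]. *)
Lemma gexp_rec a k f (M : nat) :
  (forall r s g, a r (a s g) = a s (a r g)) -> k <= M%:Z ->
  k%:~R *: gexp (fun r => a r) k f =
  \sum_(r < M) r.+1%:R *: a r.+1 (gexp (fun r => a r) (k - r.+1%:Z) f).
Proof.
move=> aC kM; rewrite (@gexp_len _ _ _ M.+2); last by lia.
rewrite big_ord_recl len_coef0 scalerDr.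
(* The term of length 0 lives only at [k = 0], where the factor [k] kills it. *)
have -> : k%:~R *: (((ord0 : 'I_M.+2)`!%:R : K)^-1 *: (if k == 0 then f else 0)) = 0.
  by case: eqP => [->|]; rewrite ?scale0r // !scaler0.
rewrite add0r scaler_sumr.
under [RHS]eq_bigr => r _.
  rewrite (@gexp_len _ _ _ M.+1); last by lia.
  rewrite linear_sum scaler_sumr; over.
rewrite exchange_big /=; apply: eq_bigr => l _; rewrite scalerCA.
rewrite (len_coef_rec _ _ aC kM) scalerA factS natrM invfM mulrAC mulVf ?mul1r; last first.
  by rewrite char0.
rewrite scaler_sumr; apply: eq_bigr => r _. by rewrite scalerCA (linearZ_LR (a r.+1)).
Qed.

Lemma gexp0 (a : nat -> L -> L) f : gexp a 0 f = f.
Proof. by rewrite /gexp compositions0 big_cons big_nil addr0 invr1 scale1r. Qed.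

HB.instance Definition _ (a : nat -> {linear L -> L}) k :=
  GRing.isLinear.Build K L L *:%R (gexp (fun r => a r) k) (gexp_is_linear a k).

End ExpCoef.

(** * Reindexing finite sums *)

Section Sums.
Context (V : nmodType).

(** The hypotheses confine the support of [h] to [[0, M - m)], which both windows of summation
    contain. *)
Lemma sum_shift (h : int -> V) (m M : nat) :
  (forall k, k < 0 -> h k = 0) -> (forall k, M%:Z <= k + m%:Z -> h k = 0) ->
  \sum_(i < M) h (i%:Z - m%:Z) = \sum_(i < M) h i%:Z.
Proof.
move=> h0; elim: m => [|m IH] hM; first by under eq_bigr do rewrite subr0.
rewrite -IH => [|k kM]; last by apply: hM; lia.
case: M {IH} hM => [|M] hM; first by rewrite !big_ord0.
rewrite big_ord_recl big_ord_recr /= h0 ?add0r; last by lia.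
rewrite [h (M%:Z - _)]hM ?addr0; last by lia.
by apply: eq_bigr => i _; congr h; rewrite /= /bump; lia.
Qed.

(** Series are written below as sums up to some large bound; this makes the choice of the bound
    immaterial. *)
Lemma sum_widen (h : nat -> V) (M N : nat) :
  (forall i, (M <= i)%N -> h i = 0) -> (forall i, (N <= i)%N -> h i = 0) ->
  \sum_(i < M) h i = \sum_(i < N) h i.
Proof.
wlog MN : M N / (M <= N)%N => [W hM hN|hM _].
  by case/orP: (leq_total M N) => le; [|symmetry]; exact: W.
rewrite -(subnKC MN) big_split_ord /= [X in _ + X]big1 ?addr0 // => i _.
by apply: hM; exact: leq_addr.
Qed.

Lemma sum_antidiag (G : int -> int -> V) (M : nat) :
  (forall i j, j < 0 -> G i j = 0) -> (forall i j, M%:Z <= i + j -> G i j = 0) ->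
  \sum_(i < M) \sum_(j < M) G i%:Z j%:Z = \sum_(k < M) \sum_(i < M) G i%:Z (k%:Z - i%:Z).
Proof.
move=> G0 GM; rewrite [RHS]exchange_big; apply: eq_bigr => i _ /=.
rewrite (sum_shift (h := G i%:Z)) // => k ik; first exact: G0.
by apply: GM; rewrite addrC.
Qed.

End Sums.

(** * Families determined by their logarithmic derivative *)

Section ExpRec.
Context (K : fieldType) (char0 : forall n, n.+1%:R != 0 :> K) (L : lmodType K).
Implicit Types (c : nat -> {linear L -> L}) (A B : int -> L).

(* The families of coefficients of [exp(\sum_r c_r z^{r+1})], as in [gexp_rec]. *)
Definition exprec c A : Prop := (forall k, k < 0 -> A k = 0) /\
  forall (k : int) (M : nat), k <= M%:Z ->
    k%:~R *: A k = \sum_(r < M) r.+1%:R *: c r (A (k - r.+1%:Z)).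

(** For [k > 0] the recursion gives [k A_k] from earlier terms, and [k] is invertible. Identities
    between exponentials are proved in this way below. *)
Lemma exprec_eq c A B : exprec c A -> exprec c B -> A 0 = B 0 -> A =1 B.
Proof.
move=> [A0 rA] [B0 rB] AB0.
suff H n (k : int) : k < n%:Z -> A k = B k.
  move=> k; apply: (H `|k|.+1%N); lia.
elim: n k => [|n IH] k kn; first by rewrite A0 ?B0.
have [kn'|nk] := ltP k n%:Z; first exact: IH.
have {kn nk} -> : k = n%:Z by lia.
case: n IH => [|n] IH //; apply: (scale_int_inj char0 (k := n.+1%:Z)) => //.
rewrite (rA _ n.+1) // (rB _ n.+1) //; apply: eq_bigr => r _.
by rewrite IH //; lia.
Qed.

(** The product rule for logarithmic derivatives: [G i j] combines the coefficients [i] and [j] of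
    two families, and [U r], [W r] are the results of acting on the first and on the second one. The
    factor [k] is split as [i + (k - i)]. *)
Lemma exprec_conv c (G : int -> int -> L) (U W : nat -> int -> int -> L) (M : nat) (k : int) :
  (forall i j, i < 0 -> G i j = 0) -> (forall i j, j < 0 -> G i j = 0) ->
  (forall r i j, i < 0 -> U r i j = 0) -> (forall r i j, j < 0 -> U r i j = 0) ->
  (forall i j (N : nat), i <= N%:Z ->
     i%:~R *: G i j = \sum_(r < N) r.+1%:R *: U r (i - r.+1%:Z) j) ->
  (forall i j (N : nat), j <= N%:Z ->
     j%:~R *: G i j = \sum_(r < N) r.+1%:R *: W r i (j - r.+1%:Z)) ->
  (forall r i j, U r i j + W r i j = c r (G i j)) ->
  k < M%:Z ->
  k%:~R *: \sum_(i < M) G i%:Z (k - i%:Z) =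
  \sum_(r < M) r.+1%:R *: c r (\sum_(i < M) G i%:Z (k - r.+1%:Z - i%:Z)).
Proof.
move=> Gi Gj Ui Uj GU GW UW kM.
rewrite scaler_sumr.
under eq_bigr => i _.
  rewrite -{1}[k](subrK i%:Z) rmorphD /= scalerDl addrC.
  have iM := ltn_ord i.
  rewrite (GU _ _ M) ?(GW _ _ M); [|lia..].
  over.
rewrite big_split /= exchange_big /= [X in _ + X]exchange_big /= -big_split /=.
apply: eq_bigr => r _; rewrite -!scaler_sumr -scalerDr; congr (_ *: _).
rewrite linear_sum /=.
under [RHS]eq_bigr => i _ do rewrite -UW.
rewrite big_split /=; congr (_ + _); last first.
  by apply: eq_bigr => i _; congr W; rewrite addrAC.
(* Acting on the first family lowers [i] by [r.+1]; shifting the summation index back turns this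
   into a lower total degree. *)
rewrite -(sum_shift (h := fun i => U r i (k - r.+1%:Z - i)) (m := r.+1)).
- by apply: eq_bigr => i _; congr U; rewrite opprB addrA subrK.
- by move=> i i0; exact: Ui.
- by move=> i iM; apply: Uj; lia.
Qed.

End ExpRec.

(** * Vertex operators *)

Section Fock.
Context (K : fieldType) (char0 : forall n, n.+1%:R != 0 :> K) (L : comAlgType K).
Context (p : nat -> L) (d : nat -> {linear L -> L}).
Context (d_der : forall r f g, d r (f * g) = d r f * g + f * d r g).
Context (d_p : forall r s, d r.+1 (p s.+1) = (r == s)%:R).
Context (d_comm : forall r s f, d r (d s f) = d s (d r f)).
Implicit Types (be : nat -> K) (f g : L) (k m n : int) (M : nat).

Definition mulop be r f : L := (be r / r%:R) *: (p r * f).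
Definition opd r f : L := - d r f.

Lemma mulop_is_linear be r : linear (mulop be r).
Proof. by move=> c f g; rewrite /mulop mulrDr scalerDr -scalerAr scalerCA. Qed.
HB.instance Definition _ be r :=
  GRing.isLinear.Build K L L *:%R (mulop be r) (mulop_is_linear be r).

Lemma opd_is_linear r : linear (opd r).
Proof. by move=> c f g; rewrite /opd linearP opprD scalerN. Qed.
HB.instance Definition _ r :=
  GRing.isLinear.Build K L L *:%R (opd r) (opd_is_linear r).

(** The operators [E_k] and [D_k] of the overview. *)
Definition expd k f : L := gexp (fun r => d r) k f.
Definition expNd k f : L := gexp opd k f.
HB.instance Definition _ k := GRing.Linear.copy (expd k) (gexp (fun r => d r) k).
HB.instance Definition _ k := GRing.Linear.copy (expNd k) (gexp (fun r => opd r) k).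
(* The coefficient of [z^k] in [exp(\sum_(r >= 1) be_r p_r z^r / r)]. *)
Definition xg be k : L := gexp (mulop be) k 1.

Lemma mulopC be ga r s f : mulop be r (mulop ga s f) = mulop ga s (mulop be r f).
Proof. by rewrite /mulop -!scalerAr scalerCA mulrCA. Qed.

Lemma opdC r s f : opd r (opd s f) = opd s (opd r f).
Proof. by rewrite /opd !linearN d_comm. Qed.

Lemma opd_d r s f : opd r (d s f) = d s (opd r f).
Proof. by rewrite /opd linearN d_comm. Qed.

Lemma gexp_exprec (a : nat -> {linear L -> L}) f :
  (forall r s g, a r (a s g) = a s (a r g)) ->
  exprec (fun r => a r.+1) (fun k => gexp (fun r => a r) k f).
Proof.
move=> aC; split=> [k k0|k M kM]; first exact: gexp_neg.
by rewrite (gexp_rec char0 _ aC kM).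
Qed.

Lemma E_exprec f : exprec (fun r => d r.+1) (expd^~ f).
Proof. exact: gexp_exprec. Qed.

Lemma D_exprec f : exprec (fun r => opd r.+1) (expNd^~ f).
Proof. exact: (gexp_exprec _ opdC). Qed.

Lemma xg_exprec be : exprec (fun r => mulop be r.+1) (xg be).
Proof. exact: (gexp_exprec _ (@mulopC be be)). Qed.

Lemma xg_neg be k : k < 0 -> xg be k = 0.
Proof. exact: gexp_neg. Qed.

Lemma E_neg k f : k < 0 -> expd k f = 0.
Proof. exact: gexp_neg. Qed.

Lemma D_neg k f : k < 0 -> expNd k f = 0.
Proof. exact: gexp_neg. Qed.

Lemma xg0 be : xg be 0 = 1. Proof. exact: gexp0. Qed.
Lemma E0 f : expd 0 f = f. Proof. exact: gexp0. Qed.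
Lemma D0 f : expNd 0 f = f. Proof. exact: gexp0. Qed.

Lemma gexp_mulop be k f : gexp (mulop be) k f = xg be k * f.
Proof.
rewrite /xg /gexp mulr_suml; apply: eq_bigr => tau _; rewrite -scalerAl; congr (_ *: _).
elim: tau => [|r s IH] /=; first by rewrite mul1r.
by rewrite /mulop IH -scalerAl mulrA.
Qed.

(** Exponentials of commuting derivations are multiplicative: both sides have the same logarithmic
    derivative, by the product rule, and the same value at [k = 0]. *)
Lemma gexp_leibniz (a : nat -> {linear L -> L}) k f g M :
  (forall r f g, a r (f * g) = a r f * g + f * a r g) ->
  (forall r s g, a r (a s g) = a s (a r g)) -> k < M%:Z ->
  gexp (fun r => a r) k (f * g) =
  \sum_(i < M) gexp (fun r => a r) i%:Z f * gexp (fun r => a r) (k - i%:Z) g.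
Proof.
move=> ader aC kM; pose A f k := gexp (fun r => a r) k f.
have rA f' : exprec (fun r => a r.+1) (A f') by exact: gexp_exprec.
have Aneg f' k' : k' < 0 -> A f' k' = 0 by exact: (rA f').1.
have wid (N N' : nat) k' : k' < N%:Z -> k' < N'%:Z ->
    \sum_(i < N) A f i%:Z * A g (k' - i%:Z) = \sum_(i < N') A f i%:Z * A g (k' - i%:Z).
  move=> kN kN'; apply: (sum_widen (h := fun i : nat => A f i%:Z * A g (k' - i%:Z))) => i iM;
  by rewrite [A g _]Aneg ?mulr0 //; lia.
(* To apply [exprec_eq] the right side must be a function of [k] alone, so the bound is made to
   depend on [k]. *)
transitivity (\sum_(i < `|k|.+1) A f i%:Z * A g (k - i%:Z)); last by apply: wid; lia.
have := exprec_eq char0 (rA (f * g)) (B := fun k =>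
   \sum_(i < `|k|.+1) A f i%:Z * A g (k - i%:Z)).
apply; last by rewrite big_ord1 /A !gexp0.
split=> [k' k0|k' N kN].
  by rewrite big1 // => i _; rewrite [A g _]Aneg ?mulr0 //; lia.
rewrite (@wid _ (N + `|k'|).+1); [|lia..].
rewrite (@exprec_conv _ _ (fun r => a r.+1) (fun i j => A f i * A g j)
  (fun r i j => a r.+1 (A f i) * A g j) (fun r i j => A f i * a r.+1 (A g j))).
- rewrite (@sum_widen _ (fun r => r.+1%:R *: a r.+1
    (\sum_(i < (N + `|k'|).+1) A f i%:Z * A g (k' - r.+1%:Z - i%:Z))) _ N).
  + apply: eq_bigr => r _; congr (_ *: a _ _); apply: wid; lia.
  + by move=> i iN; rewrite big1 ?linear0 ?scaler0 // => j _; rewrite [A g _]Aneg ?mulr0 //; lia.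
  + by move=> i iN; rewrite big1 ?linear0 ?scaler0 // => j _; rewrite [A g _]Aneg ?mulr0 //; lia.
- by move=> i j i0; rewrite Aneg ?mul0r.
- by move=> i j i0; rewrite [A g _]Aneg ?mulr0.
- by move=> r i j i0; rewrite Aneg // linear0 mul0r.
- by move=> r i j i0; rewrite [A g _]Aneg // mulr0.
- move=> i j N' iN; rewrite scalerAl ((rA f).2 _ _ iN) mulr_suml.
  by apply: eq_bigr => r _; rewrite scalerAl.
- move=> i j N' iN; rewrite scalerAr ((rA g).2 _ _ iN) mulr_sumr.
  by apply: eq_bigr => r _; rewrite scalerAr.
- by move=> r i j; rewrite ader.
- lia.
Qed.

Lemma E_mul k f g M : k < M%:Z ->
  expd k (f * g) = \sum_(i < M) expd i%:Z f * expd (k - i%:Z) g.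
Proof. exact: gexp_leibniz. Qed.

Lemma D_mul k f g M : k < M%:Z ->
  expNd k (f * g) = \sum_(i < M) expNd i%:Z f * expNd (k - i%:Z) g.
Proof.
apply: (gexp_leibniz (a := opd)) => [r f1 f2|]; last exact: opdC.
by rewrite /= /opd d_der opprD mulNr mulrN.
Qed.

(** The logarithmic derivative of [D E] is [- d + d = 0], hence the operators [\0] in
    [exprec_conv]. *)
Lemma D_E_inv k f M : k < M%:Z ->
  \sum_(i < M) expNd (k - i%:Z) (expd i%:Z f) = if k == 0 then f else 0.
Proof.
move=> kM; case: eqVneq => [k0|k0].
  rewrite k0 in kM *; case: M kM => // M _; rewrite big_ord_recl subr0 D0 E0 big1 ?addr0 // => i _.
  by rewrite D_neg //= /bump; lia.
apply: (scale_int_inj char0 k0); rewrite scaler0.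
rewrite (@exprec_conv _ _ (fun=> \0) (fun i j => expNd j (expd i f))
  (fun r i j => d r.+1 (expNd j (expd i f))) (fun r i j => opd r.+1 (expNd j (expd i f)))) => //.
- by rewrite big1 // => r _; rewrite scaler0.
- by move=> i j i0; rewrite E_neg ?linear0.
- by move=> i j j0; rewrite D_neg.
- by move=> r i j i0; rewrite E_neg ?linear0.
- by move=> r i j j0; rewrite D_neg ?linear0.
- move=> i j N iN; rewrite -linearZ ((E_exprec f).2 _ _ iN) linear_sum.
  apply: eq_bigr => r _.
rewrite linearZ_LR; congr (_ *: _).
  by symmetry; apply: gexp_comm => r' g; rewrite opd_d.
- by move=> i j N iN; rewrite ((D_exprec _).2 _ _ iN).
- by move=> r i j; rewrite /opd subrr.
Qed.

Lemma d1 r : d r 1 = 0.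
Proof.
have := d_der r 1 1; rewrite !mulr1 mul1r => /eqP.
by rewrite -subr_eq subrr => /eqP.
Qed.

Lemma d_mulop be r s f : d r.+1 (mulop be s.+1 f) =
  mulop be s.+1 (d r.+1 f) + (be s.+1 / s.+1%:R) *: (f *+ (r == s)).
Proof.
rewrite /mulop linearZ /= d_der d_p scalerDr addrC; congr (_ + _ *: _).
by rewrite mulr_natl.
Qed.

(** This is the chain rule for [exp(\sum_r be_r p_r z^r / r)], proved on coefficients by induction
    along the recursion. *)
Lemma d_xg be r k : d r.+1 (xg be k) = (be r.+1 / r.+1%:R) *: xg be (k - r.+1%:Z).
Proof.
suff H (b : nat) (j : int) : j < b%:Z -> d r.+1 (xg be j) = (be r.+1 / r.+1%:R) *: xg be (j - r.+1%:Z).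
  apply: (H `|k|.+1%N); lia.
elim: b j => [|b IH] j jb; first by rewrite !xg_neg ?linear0 ?scaler0 //; lia.
have [j0|j0] := eqVneq j 0.
  by rewrite j0 xg0 d1 xg_neg ?scaler0 //; lia.
apply: (scale_int_inj char0 j0).
(* Large enough for the recursions at [j] and at [j - r.+1], and for the index [r] to occur in the
   sum. *)
pose N := (`|j| + r.+1)%N.
rewrite -linearZ /= ((xg_exprec be).2 _ N); last by rewrite /N; lia.
rewrite linear_sum /=.
under eq_bigr => s _.
  rewrite linearZ /= d_mulop IH; last by lia.
  rewrite linearZ /= scalerDr scalerCA.
  over.
rewrite big_split /= -scaler_sumr.
have -> : \sum_(i < N) i.+1%:R *: mulop be i.+1 (xg be (j - i.+1%:Z - r.+1%:Z)) =
          (j - r.+1%:Z)%:~R *: xg be (j - r.+1%:Z).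
  rewrite ((xg_exprec be).2 _ N); last by rewrite /N; lia.
  by apply: eq_bigr => s _; rewrite addrAC.
have rN : (r < N)%N by rewrite /N; lia.
rewrite (bigD1 (Ordinal rN)) //= eqxx mulr1n big1 ?addr0; last first.
  move=> i ir; rewrite eq_sym; case: eqP => [e|_]; last by rewrite mulr0n !scaler0.
  by case/eqP: ir; apply: val_inj.
rewrite [r.+1%:R *: _]scalerCA -scalerDr [RHS]scalerCA; congr (_ *: _).
rewrite pmulrn -scalerDl -rmorphD /=; congr (_%:~R *: _); lia.
Qed.

(** The operator [E(y)] shifts each [p_r] by [y^r], so it multiplies [x(z)] by [ep(y z)] with
    [ep(w) = exp(\sum_r be_r w^r / r)]; the hypotheses characterize this series. *)
Lemma E_xg be (ep : int -> K) k n :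
  (forall i, i < 0 -> ep i = 0) -> ep 0 = 1 ->
  (forall (i : int) M, i <= M%:Z -> i%:~R * ep i = \sum_(r < M) be r.+1 * ep (i - r.+1%:Z)) ->
  expd k (xg be n) = ep k *: xg be (n - k).
Proof.
move=> ep_neg ep0 ep_rec.
apply: (exprec_eq char0 (E_exprec _) (B := fun k => ep k *: xg be (n - k))); last first.
  by rewrite E0 ep0 scale1r subr0.
split=> [i i0|i M iM]; first by rewrite ep_neg ?scale0r.
rewrite scalerA (ep_rec _ _ iM) scaler_suml; apply: eq_bigr => r _.
rewrite linearZ /= d_xg !scalerA; congr (_ *: xg _ _); last by lia.
by field; rewrite addrC natr1 char0.
Qed.

Context (dg : L -> nat).
Context (dgP : forall f tau, is_composition tau -> (dg f < sumn tau)%N ->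
  foldr (fun r => d r) f tau = 0).

Lemma foldr_opd tau f : foldr opd f tau = (-1) ^+ size tau *: foldr (fun r => d r) f tau.
Proof.
elim: tau => [|r s IH] /=; first by rewrite scale1r.
by rewrite IH /opd linearZ exprS mulN1r scaleNr.
Qed.

(** The degree bounds the total weight of the derivatives, so the condition is on [i + j]; the
    double sum in [xg_vop] is cut off in this form. *)
Lemma D_E_dg i j f : (dg f)%:Z < i + j -> expNd i (expd j f) = 0.
Proof.
move=> fij; rewrite /expd /gexp linear_sum /= big_seq big1 // => s.
rewrite mem_compositions => /andP[cs /eqP sj].
rewrite (linearZ_LR (expNd i)) /= /expNd /gexp [X in _ *: X]big_seq big1 ?scaler0 // => r.
rewrite mem_compositions => /andP[cr /eqP ri].
rewrite foldr_opd -foldr_cat dgP ?scaler0 //.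
  by rewrite /is_composition all_cat; apply/andP.
by rewrite -ltz_nat (lt_le_trans fij) // sumn_cat -sj -ri -PoszD lez_nat.
Qed.

Lemma E_dg k f : (dg f)%:Z < k -> expd k f = 0.
Proof. by move=> fk; rewrite -[expd k f]D0 D_E_dg // add0r. Qed.

Lemma D_dg k f : (dg f)%:Z < k -> expNd k f = 0.
Proof. by move=> fk; rewrite -[f]E0 D_E_dg // addr0. Qed.

Definition vop be n f : L :=
  \sum_(j < (dg f).+1) gexp (mulop be) (n + j%:Z) (expNd j%:Z f).

(** The cut at [dg f] in [vop] depends on [f]; a free bound allows a common one for several
    arguments, as linearity requires. *)
Lemma vopE be n f M : (dg f < M)%N ->
  vop be n f = \sum_(j < M) xg be (n + j%:Z) * expNd j%:Z f.
Proof.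
move=> fM; rewrite /vop; under eq_bigr => j _ do rewrite gexp_mulop.
by apply: (sum_widen (h := fun j : nat => xg be (n + j%:Z) * expNd j%:Z f)) => j jM;
  rewrite D_dg ?mulr0 //; lia.
Qed.

Lemma vop_is_linear be n : linear (vop be n).
Proof.
move=> c f g; pose M := (dg f + dg g + dg (c *: f + g)).+1.
have M1 : (dg f < M)%N by rewrite /M; lia.
have M2 : (dg g < M)%N by rewrite /M; lia.
have M3 : (dg (c *: f + g) < M)%N by rewrite /M; lia.
rewrite (vopE _ _ M1) (vopE _ _ M2) (vopE _ _ M3).
rewrite scaler_sumr -big_split /=; apply: eq_bigr => j _.
by rewrite linearP mulrDr scalerAr.
Qed.
HB.instance Definition _ be n :=
  GRing.isLinear.Build K L L *:%R (vop be n) (vop_is_linear be n).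

(** From [X(z) E(1/z) = x(z) D(1/z) E(1/z) = x(z)]. *)
Lemma xg_vop be n f M : (dg f < M)%N ->
  xg be n * f = \sum_(j < M) vop be (n + j%:Z) (expd j%:Z f).
Proof.
move=> fM; pose N := (M + \sum_(j < M) (dg (expd j%:Z f)).+1)%N.
under eq_bigr => j _.
  rewrite (@vopE _ _ _ N); last first.
    rewrite /N (bigD1 j) //=; lia.
  over.
rewrite (sum_widen (N := N) (h := fun j : nat => \sum_(i < N)
    xg be (n + j%:Z + i%:Z) * expNd i%:Z (expd j%:Z f))); first last.
- move=> j jN; rewrite big1 // => i _; rewrite D_E_dg ?mulr0 // -PoszD ltz_nat.
  rewrite (leq_trans fM) // (leq_trans _ (leq_addl _ _)) // (leq_trans _ jN) //.
  by rewrite /N leq_addr.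
- move=> j jM; rewrite big1 // => i _; rewrite D_E_dg ?mulr0 // -PoszD ltz_nat.
  by rewrite (leq_trans fM) // (leq_trans jM) // leq_addl.
rewrite (sum_antidiag (G := fun j i => xg be (n + j + i) * expNd i (expd j f))); first last.
- move=> i j Nij; rewrite D_E_dg ?mulr0 // addrC (lt_le_trans _ Nij) // ltz_nat.
  by rewrite (leq_trans fM) // /N leq_addr.
- by move=> i j j0; rewrite D_neg ?mulr0.
have N0 : (0 < N)%N by rewrite /N; lia.
case: N N0 {fM} => // N _.
under eq_bigr => k _.
  under eq_bigr => i _ do rewrite -addrA [i%:Z + _]addrC subrK.
  rewrite -mulr_sumr D_E_inv; last by rewrite ltz_nat.
  over.
rewrite big_ord_recl /= addr0 big1 ?addr0 // => i _.
by rewrite mulr0.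
Qed.

(** * Exchange relations with a scalar series [ep] *)

Section ExpWeights.
Context (be : nat -> K) (ep : int -> K).
Context (ep_neg : forall i, i < 0 -> ep i = 0).
Context (ep_xg : forall k n, expd k (xg be n) = ep k *: xg be (n - k)).

Lemma E_xg_mul k n f M : k < M%:Z ->
  expd k (xg be n * f) = \sum_(i < M) ep i%:Z *: (xg be (n - i%:Z) * expd (k - i%:Z) f).
Proof.
by move=> kM; rewrite (E_mul _ _ kM); apply: eq_bigr => i _; rewrite ep_xg scalerAl.
Qed.

Lemma E_D_comm k j f : expd k (expNd j f) = expNd j (expd k f).
Proof.
by symmetry; apply: (gexp_comm (c := expNd j)) => r g; symmetry; apply: gexp_comm => s h; rewrite opd_d.
Qed.

(** [E(y)] is multiplicative, multiplies [x(z)] by [ep(y z)] and commutes with [D]. *)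
Lemma E_vop k n f M : k < M%:Z ->
  expd k (vop be n f) = \sum_(i < M) ep i%:Z *: vop be (n - i%:Z) (expd (k - i%:Z) f).
Proof.
move=> kM; pose N := (dg f + \sum_(i < M) (dg (expd (k - i%:Z) f)).+1).+1.
rewrite (@vopE _ _ _ N); last by rewrite /N; lia.
rewrite linear_sum /=.
under eq_bigr => j _ do rewrite (E_xg_mul _ _ kM).
rewrite exchange_big /=; apply: eq_bigr => i _; rewrite -scaler_sumr; congr (_ *: _).
rewrite (@vopE _ _ _ N); last by rewrite /N (bigD1 i) //=; lia.
by apply: eq_bigr => j _; rewrite E_D_comm addrAC.
Qed.

(** This is [x(z) D(y) = ep(y z) D(y) x(z)]. No inverse of [ep] appears, because [D E = 1] is
    inserted on the factor [x(z)] instead. *)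
Lemma xg_D n j f M : (j < M)%N ->
  xg be n * expNd j%:Z f = \sum_(i < M) ep i%:Z *: expNd (j%:Z - i%:Z) (xg be (n - i%:Z) * f).
Proof.
move=> jM.
transitivity (\sum_(i < M) \sum_(l < M)
   expNd l%:Z (expd i%:Z (xg be n)) * expNd (j%:Z - i%:Z - l%:Z) f); last first.
  apply: eq_bigr => i _; rewrite (@D_mul _ _ _ M) ?scaler_sumr; last by lia.
  by apply: eq_bigr => l _; rewrite ep_xg linearZ_LR scalerAl.
rewrite (sum_antidiag (G := fun i l => expNd l (expd i (xg be n)) * expNd (j%:Z - i - l) f)); first last.
- by move=> i l il; rewrite [expNd _ f]D_neg ?mulr0 //; lia.
- by move=> i l l0; rewrite D_neg ?mul0r.
under eq_bigr => k _.
  under eq_bigr => i _ do rewrite opprB addrA subrK.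
  rewrite -mulr_suml D_E_inv; last by rewrite ltz_nat.
  over.
case: M jM => // M _; rewrite big_ord_recl /= subr0 big1 ?addr0 // => i _.
by rewrite mul0r.
Qed.

(** This is [x(w) X(z) = ep(w/z) X(z) x(w)]: multiplications commute, and [xg_D] moves [x(w)] past
    [D(1/z)]. *)
Lemma xg_mul_vop m n f M : m < M%:Z ->
  xg be m * vop be n f = \sum_(i < M) ep i%:Z *: vop be (n + i%:Z) (xg be (m - i%:Z) * f).
Proof.
move=> mM; pose N := (M + dg f + \sum_(i < M) (dg (xg be (m - i%:Z) * f)).+1).+1.
rewrite (@vopE _ _ f N); last by rewrite /N; lia.
rewrite mulr_sumr.
under eq_bigr => j _ do rewrite mulrCA (xg_D _ _ (ltn_ord j)) mulr_sumr.
rewrite exchange_big /=.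
rewrite (sum_widen (N := M) (h := fun i : nat => \sum_(j < N) xg be (n + j%:Z) *
  (ep i%:Z *: expNd (j%:Z - i%:Z) (xg be (m - i%:Z) * f)))); first last.
- by move=> i iM; rewrite big1 // => j _; rewrite [xg be (m - _)]xg_neg ?mul0r ?linear0 ?scaler0 ?mulr0 //; lia.
- move=> i iM; rewrite big1 // => j _; rewrite [xg be (m - _)]xg_neg ?mul0r ?linear0 ?scaler0 ?mulr0 //.
  by rewrite /N in iM; lia.
apply: eq_bigr => i _.
under eq_bigr do rewrite -scalerAr.
rewrite -scaler_sumr; congr (_ *: _).
have iN : (dg (xg be (m - i%:Z) * f) + i < N)%N.
  by have iM := ltn_ord i; rewrite /N (bigD1 i) //=; lia.
rewrite (@vopE _ _ _ N); last by lia.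
rewrite -(sum_shift (h := fun j => xg be (n + i%:Z + j) * expNd j (xg be (m - i%:Z) * f)) (m := i)).
- by apply: eq_bigr => j _; congr (xg _ _ * _); rewrite -addrA [i%:Z + _]addrC subrK.
- by move=> k k0; rewrite D_neg ?mulr0.
- by move=> k Nk; rewrite D_dg ?mulr0 //; lia.
Qed.

End ExpWeights.

(** * The series [(1 - b z) / (1 - a z)] *)

Definition eps (a b : K) (k : int) : K :=
  match k with Posz 0 => 1 | Posz n.+1 => (a - b) * a ^+ n | Negz _ => 0 end.

Lemma eps_neg a b k : k < 0 -> eps a b k = 0.
Proof. by case: k. Qed.

(* [(1 - b z) / (1 - a z) = exp(\sum_r (a^r - b^r) z^r / r)] *)
Lemma eps_rec a b k M : k <= M%:Z -> k%:~R * eps a b k =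
  \sum_(r < M) (a ^+ r.+1 - b ^+ r.+1) * eps a b (k - r.+1%:Z).
Proof.
move=> kM; have [k0|k0] := ltP k 0.
  by rewrite eps_neg // mulr0 big1 // => r _; rewrite eps_neg ?mulr0 //; lia.
case: k k0 kM => // n _ nM.
rewrite (sum_widen (N := n) (h := fun r : nat => (a ^+ r.+1 - b ^+ r.+1) * eps a b (n%:Z - r.+1%:Z))); first last.
- by move=> r nr; rewrite eps_neg ?mulr0 //; lia.
- by move=> r nr; rewrite eps_neg ?mulr0 //; lia.
case: n {nM} => [|n]; first by rewrite big_ord0 mul0r.
rewrite /= -pmulrn.
elim: n => [|n IH]; first by rewrite big_ord1 subrr !mulr1 mul1r.
have E r : (r <= n)%N -> eps a b (n.+1%:Z - r%:Z) = (a - b) * a ^+ (n - r)%N.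
  by move=> rn; rewrite (_ : n.+1%:Z - r%:Z = (n - r).+1%:Z) //; lia.
have {}IH : \sum_(i < n) (a ^+ i.+1 - b ^+ i.+1) * ((a - b) * a ^+ (n - i.+1)%N) =
   n.+1%:R * ((a - b) * a ^+ n) - (a ^+ n.+1 - b ^+ n.+1).
  rewrite IH big_ord_recr /= subrr mulr1 addrK; apply: eq_bigr => i _.
  by rewrite E.
rewrite big_ord_recr big_ord_recr /= subrr mulr1.
have -> : eps a b (n.+2%:Z - n.+1%:Z) = a - b.
  by rewrite (_ : n.+2%:Z - n.+1%:Z = 1%N%:Z) /= ?mulr1 //; lia.
(* The sum for [n.+2] is [a] times the sum for [n.+1] without its last term, plus the two terms with
   [eps] at 1 and at 0. *)
transitivity (a * (n.+1%:R * ((a - b) * a ^+ n) - (a ^+ n.+1 - b ^+ n.+1)) +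
  (a ^+ n.+1 - b ^+ n.+1) * (a - b) + (a ^+ n.+2 - b ^+ n.+2)).
  by rewrite -[n.+2%:R]natr1 !exprS; ring.
rewrite -IH mulr_sumr; congr (_ + _ + _); apply: eq_bigr => i _.
rewrite (_ : n.+2%:Z - i.+1%:Z = (n - i.+1).+2%:Z) /=; last by have := ltn_ord i; lia.
by set m := (n - i.+1)%N; rewrite [a ^+ m.+1]exprS; ring.
Qed.

Lemma E_xg_weight be a b k n : (forall r, be r = a ^+ r - b ^+ r) ->
  expd k (xg be n) = eps a b k *: xg be (n - k).
Proof.
move=> beE; apply: E_xg => //; first exact: eps_neg.
by move=> i M iM; rewrite (eps_rec _ _ iM); apply: eq_bigr => r _; rewrite beE.
Qed.

(** * The operators [E_k] on products of vertex operators *)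

Definition wt (u : K) (r : nat) : K := 1 - u ^+ r.

Lemma wtE u r : wt u r = 1 ^+ r - u ^+ r. Proof. by rewrite expr1n. Qed.

Lemma E_xg_wt u k n : expd k (xg (wt u) n) = eps 1 u k *: xg (wt u) (n - k).
Proof. exact: (E_xg_weight _ _ (wtE u)). Qed.

Lemma E1 k : 0 < k -> expd k 1 = 0.
Proof. by move=> k0; rewrite -(xg0 (wt 0)) E_xg_wt xg_neg ?scaler0 //; lia. Qed.

(** Here [ep] has coefficients [1, 1 - u, 1 - u, ...], so [E_vop] contributes [X_b E_k] and [1 - u]
    times the part [j < k] of [x_{b-k} = \sum_j X_{b-k+j} E_j]. Completing that series costs its
    term [j = k], which turns the coefficient of [X_b E_k] into [u], and its tail. *)
Lemma E_vop_wt u (k : nat) (b : int) f M : (0 < k)%N -> (dg f < M)%N ->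
  expd k%:Z (vop (wt u) b f) = u *: vop (wt u) b (expd k%:Z f)
    + (1 - u) *: (xg (wt u) (b - k%:Z) * f)
    - (1 - u) *: \sum_(i < M) vop (wt u) (b + i.+1%:Z) (expd (k%:Z + i.+1%:Z) f).
Proof.
move=> k0 fM.
rewrite (@E_vop _ (eps 1 u) (E_xg_wt u) _ _ _ k.+1) ?ltz_nat //.
rewrite (@xg_vop _ _ _ (k + M.+1)); last by lia.
rewrite big_split_ord /= [X in _ *: (_ + X)]big_ord_recl /= addn0 subrK !scalerDr.
rewrite (eq_bigr (fun i : 'I_M => vop (wt u) (b + i.+1%:Z) (expd (k%:Z + i.+1%:Z) f))); last first.
  by move=> i _; rewrite /= /bump; congr (vop _ _ _); lia.
rewrite big_ord_recl /= subr0 subr0 scale1r.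
rewrite [_ + ((1 - u) *: _ + _)]addrA addrA addrK.
have -> : \sum_(i < k) vop (wt u) (b - k%:Z + i%:Z) (expd i%:Z f) =
          \sum_(i < k) vop (wt u) (b - i.+1%:Z) (expd (k%:Z - i.+1%:Z) f).
  rewrite (reindex_inj rev_ord_inj); apply: eq_bigr => i _ /=.
  by have ik := ltn_ord i; congr (vop _ _ (expd _ _)); lia.
rewrite addrAC -scalerDl [u + _]addrC subrK scale1r scaler_sumr; congr (_ + _).
by apply: eq_bigr => i _; rewrite expr1n mulr1.
Qed.

Definition vseq be (nu : seq int) : L := foldr (vop be) 1 nu.
Definition vseqn be (la : seq nat) : L := vseq be [seq a%:Z | a <- la].

Lemma E_vseq_opp (xi : seq nat) (k : nat) : (0 < k)%N ->
  expd k%:Z (vseqn (wt (-1)) xi) =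
  \sum_(i < size xi) (2 * (-1) ^+ i) *:
    (xg (wt (-1)) ((nth 0%N xi i)%:Z - k%:Z) * vseqn (wt (-1)) (del_nth i xi)).
Proof.
elim: xi k => [|b xi IH] k k0; first by rewrite big_ord0 E1.
set be := wt (-1); pose f := vseqn be xi.
have [M fM xM] : exists2 M, (dg f < M)%N & (sumn xi < M)%N.
  by exists (dg f + sumn xi).+1; lia.
rewrite /vseqn /= -/(vseqn be xi) -/f (@E_vop_wt _ _ _ _ M) //.
rewrite IH // -/be [RHS]big_ord_recl /= expr0 mulr1 /del_nth /= drop0 -/be -/(vseqn be xi) -/f.
rewrite opprK scaleN1r [- _ + _]addrC -addrA; congr (_ + _).
rewrite (linear_sum (vop be b)) /= -opprD scaler_sumr.
under [X in - (_ + X)]eq_bigr => i _.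
  rewrite (_ : k%:Z + i.+1%:Z = (k + i.+1)%N%:Z) // IH ?addn_gt0 ?k0 // -/be (linear_sum (vop be _)) scaler_sumr /=.
  over.
rewrite exchange_big /= -big_split -sumrN /=; apply: eq_bigr => j _.
have jM : (nth 0%N xi j)%:Z - k%:Z < M.+1%:Z.
  have xj : (nth 0%N xi j <= sumn xi)%N by exact: mem_le_sumn (mem_nth 0%N (ltn_ord j)).
  by lia.
(* At [u = -1] the weights of [xg_mul_vop] are [1, 2, 2, ...], which are exactly the coefficients of
   [X_b E_k] and of the tail in the exchange relation. These terms therefore combine into one sign
   change when [s] is moved to the left of [X_b]. *)
rewrite -/(vseqn be _) (xg_mul_vop (E_xg_wt (-1)) _ _ jM) big_ord_recl /= scale1r subr0 addr0.
rewrite linearZ /= /bump /= add1n exprS mulN1r mulrN scaleNr scalerDr; congr (- (_ + _)).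
rewrite scaler_sumr; apply: eq_bigr => i _.
rewrite linearZ /= /bump /= expr1n mulr1 opprK scalerCA; congr (_ *: (_ *: vop _ _ (xg _ _ * _))).
by lia.
Qed.

(** The tail of the exchange relation vanishes by hypothesis, and for [b <= k] the factor [x_{b-k}]
    is 1 or 0. *)
Lemma E_vop_top u (k b : nat) f : (0 < k)%N -> (b <= k)%N ->
  (forall j : nat, (k < j)%N -> expd j%:Z f = 0) ->
  expd k%:Z (vop (wt u) b%:Z f) =
  u *: vop (wt u) b%:Z (expd k%:Z f) + (if b == k then (1 - u) *: f else 0).
Proof.
move=> k0 bk Ef; rewrite (@E_vop_wt _ _ _ _ (dg f).+1) // big1 ?scaler0 ?subr0; last first.
  by move=> i _; rewrite -PoszD Ef ?linear0 // -addSnnS ltn_addr.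
congr (_ + _); case: eqVneq => [->|nbk]; first by rewrite subrr xg0 mul1r.
by rewrite xg_neg ?mul0r ?scaler0 //; lia.
Qed.

Lemma E_vseq_gt u (nu : seq nat) (k : nat) : (0 < k)%N -> all (fun b => b < k)%N nu ->
  expd k%:Z (vseqn (wt u) nu) = 0.
Proof.
elim: nu k => [|b nu IH] k k0 /=; first by rewrite E1.
move=> /andP[bk nuk]; rewrite /vseqn /= -/(vseqn _ nu) E_vop_top // ?(ltnW bk) //.
  by rewrite IH // linear0 scaler0 add0r ltn_eqF.
move=> j kj; apply: IH; first exact: leq_trans kj.
by apply: sub_all nuk => c ck; exact: ltn_trans kj.
Qed.

(** Each further copy of [a] changes the factor by [u (1 - u^m) + (1 - u) = 1 - u^(m+1)], and [E_a]
    kills what remains after the last copy. *)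
Lemma E_vseq_max u (a : nat) (nu : seq nat) : (0 < a)%N -> sorted geq (a :: nu) ->
  expd a%:Z (vseqn (wt u) (a :: nu)) = (1 - u ^+ (count_mem a (a :: nu))) *: vseqn (wt u) nu.
Proof.
move=> a0; elim: nu => [|b nu IH] sa.
  rewrite /vseqn /= E_vop_top //; last by move=> j aj; rewrite E1 // ltz_nat; exact: leq_trans aj.
  by rewrite E1 // linear0 scaler0 add0r !eqxx /= addn0 expr1.
have ball : all (fun c => c <= a)%N (b :: nu).
  by move: sa; rewrite /= -/(path geq a (b :: nu)) (path_sortedE geq_trans) => /andP[].
rewrite /vseqn /= -/(vseqn _ nu) -/(vop _ b%:Z _) -/(vseqn _ (b :: nu)).
rewrite -[vop (wt u) b%:Z (vseqn _ nu)]/(vseqn (wt u) (b :: nu)) E_vop_top // ?eqxx; last first.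
  move=> j aj; apply: E_vseq_gt; first exact: leq_trans aj.
  by apply: sub_all ball => c ca; exact: leq_ltn_trans aj.
case/andP: (sa) => /= ba pb.
move: ba; rewrite leq_eqVlt => /predU1P[ba|ba].
  rewrite ba eqxx in sa pb *; rewrite IH // linearZ /=.
  rewrite -/(vseqn _ nu) -[vop _ _ (vseqn _ nu)]/(vseqn (wt u) (a :: nu)) scalerA -scalerDl.
  by congr (_ *: _); rewrite eqxx /= !add1n !exprS; ring.
rewrite (ltn_eqF ba) E_vseq_gt //; last first.
  apply/allP => c; rewrite inE => /predU1P[->//|cnu].
  have /= cb := allP (order_path_min geq_trans pb) _ cnu.
  exact: leq_ltn_trans ba.
rewrite linear0 scaler0 add0r; congr (_ *: _).
have -> : count_mem a nu = 0%N.
  apply/count_memPn/negP => anu; have /= ab := allP (order_path_min geq_trans pb) _ anu.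
  by move: ba; rewrite ltnNge ab.
by rewrite expr1.
Qed.

(** * Adjoint operators and orthogonality *)

Context (t : K) (t_wt : forall r, 1 - t ^+ r.+1 != 0).
Context (ip : L -> {scalar L}).
Context (ip_sym : forall f g, ip f g = ip g f).
Context (ip_p : forall r f g, ip (p r.+1 * f) g = (r.+1%:R / (1 - t ^+ r.+1)) * ip f (d r.+1 g)).
Context (ip11 : ip 1 1 = 1).

Lemma ip0l f : ip 0 f = 0. Proof. by rewrite ip_sym linear0. Qed.
Lemma ipZl c f g : ip (c *: f) g = c * ip f g.
Proof. by rewrite ip_sym linearZ /= ip_sym. Qed.
Lemma ip_suml (I : Type) (r : seq I) (P : pred I) (G : I -> L) g :
  ip (\sum_(i <- r | P i) G i) g = \sum_(i <- r | P i) ip (G i) g.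
Proof. by rewrite ip_sym linear_sum; apply: eq_bigr => i _; rewrite ip_sym. Qed.

Lemma ip_mulop be r f g :
  ip (mulop be r.+1 f) g = (be r.+1 / (1 - t ^+ r.+1)) * ip f (d r.+1 g).
Proof.
by rewrite /mulop ipZl ip_p !mulrA divfK ?char0.
Qed.

(** Taking adjoints reverses products, but each family commutes, so the recursion reduces the claim
    to single operators. *)
Lemma gexp_adjoint (a b : nat -> {linear L -> L}) k f g :
  (forall r s g, a r (a s g) = a s (a r g)) ->
  (forall r s g, b r (b s g) = b s (b r g)) ->
  (forall r f g, ip (a r.+1 f) g = ip f (b r.+1 g)) ->
  ip (gexp (fun r => a r) k f) g = ip f (gexp (fun r => b r) k g).
Proof.
move=> aC bC ab.
suff H (n : nat) (j : int) : j < n%:Z -> forall g,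
    ip (gexp (fun r => a r) j f) g = ip f (gexp (fun r => b r) j g).
  apply: (H `|k|.+1%N); lia.
elim: n j => [|n IH] j jn {}g; first by rewrite !gexp_neg // ip0l linear0.
have [->|j0] := eqVneq j 0; first by rewrite !gexp0.
have jN : j <= `|j|%N%:Z by lia.
have jne : (j%:~R : K) != 0.
  by case: (j) j0 => [[|m]|m] // _; rewrite ?NegzE ?mulrNz ?oppr_eq0 -pmulrn char0.
apply: (mulfI jne); rewrite -ipZl (gexp_rec char0 f aC jN) ip_suml.
rewrite -[RHS](linearZ_LR (ip f)) (gexp_rec char0 g bC jN) linear_sum /=.
apply: eq_bigr => r _; rewrite ipZl linearZ /= ab IH; last by lia.
congr (_ * ip f _); symmetry; apply: gexp_comm => s h; exact: bC.
Qed.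

(** The weights [1 - t^r] cancel the denominators in the form, so that the adjoint of [q] is exactly
    [E]. *)
Lemma ip_xg k f g : ip (xg (wt t) k * f) g = ip f (expd k g).
Proof.
rewrite -gexp_mulop; apply: (gexp_adjoint (a := mulop (wt t)) (b := d)).
- exact: mulopC.
- exact: d_comm.
- by move=> r f1 g1; rewrite ip_mulop /wt divff ?mul1r.
Qed.

(* The weights of [1/q] for [q = xg (wt t)], and those of [s/q] for
   [s = xg (wt (-1))]. *)
Definition wtN r := - wt t r.

Lemma ip_D k f g : ip (expNd k f) g = ip f (xg wtN k * g).
Proof.
rewrite -gexp_mulop; apply: (gexp_adjoint (a := opd) (b := mulop wtN)).
- exact: opdC.
- exact: mulopC.
- move=> r f1 g1; rewrite [RHS]ip_sym ip_mulop /wtN /wt /= /opd mulNr divff // mulN1r.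
  by rewrite ip_sym linearN.
Qed.

Lemma ip_vop n f g M : (dg g)%:Z < n + M%:Z ->
  ip (vop (wt t) n f) g = \sum_(j < M) ip f (xg wtN j%:Z * expd (n + j%:Z) g).
Proof.
move=> gM; rewrite (@vopE _ _ _ (dg f).+1) // ip_suml.
under eq_bigr => j _ do rewrite ip_xg ip_D.
(* Terms beyond [dg f] vanish on the side of [D], those beyond [M] on the side of [E]. *)
apply: (sum_widen (h := fun j : nat => ip f (xg wtN j%:Z * expd (n + j%:Z) g))) => j jM.
  by rewrite -ip_D D_dg ?ip0l //; lia.
by rewrite E_dg ?mulr0 ?linear0 //; lia.
Qed.

Local Notation H := (vseqn (wt t)).

(** In the adjoint of [H_a] only the term [j = 0] survives, since [E_{a+j}] with [j > 0] kills a
    product whose indices are at most [a]. *)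
Lemma ip_H_cons (a : nat) la (nu : seq nat) : (0 < a)%N -> all (fun b => b <= a)%N nu ->
  ip (H (a :: la)) (H nu) = ip (H la) (expd a%:Z (H nu)).
Proof.
move=> a0 nua; rewrite /vseqn /= -/(vseqn _ la) -/(vseqn _ nu).
rewrite (@ip_vop _ _ _ (dg (H nu)).+1); last by lia.
rewrite big_ord_recl /= xg0 mul1r addr0 big1 ?addr0 // => i _.
rewrite -PoszD E_vseq_gt ?mulr0 ?linear0 //; first by rewrite addn_gt0 a0.
by apply: sub_all nua => c ca; rewrite (leq_ltn_trans ca) // /bump addnS ltnS leq_addr.
Qed.

(** The factor [b_la(t)], in the form in which the parts are removed one at a time. *)
Fixpoint hlb (la : seq nat) : K :=
  if la is a :: nu then (1 - t ^+ (count_mem a la)) * hlb nu else 1.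

(** By symmetry the larger first part can be put on the left, where its [E] kills the other side;
    equal first parts are removed together by [E_vseq_max]. *)
Lemma H_orthogonal (la nu : seq nat) : is_partition la -> is_partition nu ->
  ip (H la) (H nu) = if la == nu then hlb la else 0.
Proof.
have cons_all a s : is_partition (a :: s) -> [/\ (0 < a)%N, is_partition s & all (fun b => b <= a)%N s].
  rewrite /is_partition /= (path_sortedE geq_trans) => /and3P[/andP[sa ss] a0 cs].
  by split=> //; apply/andP.
elim: la nu => [|a la IH] [|b nu] pla pnu.
- exact: ip11.
- have [b0 _ _] := cons_all _ _ pnu.
  by rewrite ip_sym ip_H_cons // E1 // linear0.
- have [a0 _ _] := cons_all _ _ pla.
  by rewrite ip_H_cons // E1 // linear0.
have [a0 pla' laa] := cons_all _ _ pla; have [b0 pnu' nub] := cons_all _ _ pnu.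
have [ab|ba|ab] := ltngtP a b.
- rewrite ip_sym ip_H_cons //=; last by rewrite (ltnW ab) (sub_all _ laa) // => c ca; rewrite (leq_trans ca) // ltnW.
  rewrite E_vseq_gt ?linear0 //=; first by rewrite eqseq_cons (ltn_eqF ab).
  by rewrite ab (sub_all _ laa) // => c ca; rewrite (leq_ltn_trans ca).
- rewrite ip_H_cons //=; last by rewrite (ltnW ba) (sub_all _ nub) // => c ca; rewrite (leq_trans ca) // ltnW.
  rewrite E_vseq_gt ?linear0 //=; first by rewrite eqseq_cons (gtn_eqF ba).
  by rewrite ba (sub_all _ nub) // => c ca; rewrite (leq_ltn_trans ca).
- rewrite -{b}ab in pnu nub b0 *.
  rewrite ip_H_cons //=; last by rewrite leqnn.
  rewrite E_vseq_max // ?linearZ /= ?IH //; last by case/andP: pnu.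
  rewrite eqseq_cons eqxx /=; case: eqP => [->|_]; last by rewrite mulr0.
  by [].
Qed.

(** * The recursion for the scalar products *)

Definition wtG r := t ^+ r - (-1) ^+ r.

(** Weights add when exponentials multiply: [wtG r] is [wtN r + wt (-1) r]. *)
Lemma xg_wtG k M : k < M%:Z ->
  \sum_(j < M) xg wtN j%:Z * xg (wt (-1)) (k - j%:Z) = xg wtG k.
Proof.
move=> kM.
pose A k := \sum_(j < `|k|.+1) xg wtN j%:Z * xg (wt (-1)) (k - j%:Z).
have wid (N N' : nat) k' : k' < N%:Z -> k' < N'%:Z ->
    \sum_(i < N) xg wtN i%:Z * xg (wt (-1)) (k' - i%:Z) =
    \sum_(i < N') xg wtN i%:Z * xg (wt (-1)) (k' - i%:Z).
  move=> kN kN'; apply: (sum_widen (h := fun i : nat => xg wtN i%:Z * xg (wt (-1)) (k' - i%:Z))) => i iM;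
  by rewrite [xg (wt _) _]xg_neg ?mulr0 //; lia.
rewrite (@wid _ `|k|.+1); [|lia..].
apply: (exprec_eq char0 (A := A) _ (xg_exprec wtG)); last by rewrite /A big_ord1 !xg0 mulr1.
split=> [k' k0|k' N kN].
  by rewrite /A big1 // => i _; rewrite [xg (wt _) _]xg_neg ?mulr0 //; lia.
rewrite /A (@wid _ (N + `|k'|).+1); [|lia..].
rewrite (@exprec_conv _ _ (fun r => mulop wtG r.+1) (fun i j => xg wtN i * xg (wt (-1)) j)
  (fun r i j => mulop wtN r.+1 (xg wtN i) * xg (wt (-1)) j)
  (fun r i j => xg wtN i * mulop (wt (-1)) r.+1 (xg (wt (-1)) j))).
- rewrite (@sum_widen _ (fun r => r.+1%:R *: mulop wtG r.+1
    (\sum_(i < (N + `|k'|).+1) xg wtN i%:Z * xg (wt (-1)) (k' - r.+1%:Z - i%:Z))) _ N).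
  + apply: eq_bigr => r _; congr (_ *: mulop _ _ _); apply: wid; lia.
  + by move=> i iN; rewrite big1 ?linear0 ?scaler0 // => j _; rewrite [xg (wt _) _]xg_neg ?mulr0 //; lia.
  + by move=> i iN; rewrite big1 ?linear0 ?scaler0 // => j _; rewrite [xg (wt _) _]xg_neg ?mulr0 //; lia.
- by move=> i j i0; rewrite xg_neg ?mul0r.
- by move=> i j i0; rewrite [xg (wt _) _]xg_neg ?mulr0.
- by move=> r i j i0; rewrite xg_neg // linear0 mul0r.
- by move=> r i j i0; rewrite [xg (wt _) _]xg_neg // mulr0.
- move=> i j N' iN; rewrite scalerAl ((xg_exprec _).2 _ _ iN) mulr_suml.
  by apply: eq_bigr => r _; rewrite scalerAl.
- move=> i j N' iN; rewrite scalerAr ((xg_exprec _).2 _ _ iN) mulr_sumr.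
  by apply: eq_bigr => r _; rewrite scalerAr.
- move=> r i j; rewrite /mulop -scalerAl -scalerAr -mulrA [xg wtN _ * (_ * _)]mulrCA.
  rewrite -scalerDl -mulrDl; congr (_ *: _).
  by congr (_ / _); rewrite /wtN /wtG /wt; ring.
- lia.
Qed.

(** As [a > 0], every [E_{a+j}] in the adjoint of [H_a] is evaluated by [E_vseq_opp]; the sum over
    [j] then multiplies [s] by [1/q]. *)
Lemma ip_H_T (a : nat) f (xi : seq nat) : (0 < a)%N ->
  ip (vop (wt t) a%:Z f) (vseqn (wt (-1)) xi) =
  \sum_(i < size xi) (2 * (-1) ^+ i) *
    ip f (xg wtG ((nth 0%N xi i)%:Z - a%:Z) * vseqn (wt (-1)) (del_nth i xi)).
Proof.
move=> a0; set V := vseqn _.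
have [M VM xM] : exists2 M, (dg (V xi) < M)%N & (sumn xi < M)%N.
  by exists (dg (V xi) + sumn xi).+1; lia.
rewrite (@ip_vop _ _ _ M); last by lia.
under eq_bigr => j _.
  rewrite -PoszD E_vseq_opp ?addn_gt0 ?a0 // mulr_sumr linear_sum /=.
  over.
rewrite exchange_big /=; apply: eq_bigr => i _.
have xi_i : (nth 0%N xi i <= sumn xi)%N by exact: mem_le_sumn (mem_nth 0%N (ltn_ord i)).
rewrite -(@xg_wtG _ M); last by lia.
rewrite mulr_suml linear_sum mulr_sumr; apply: eq_bigr => j _.
rewrite -scalerAr linearZ /= mulrA; congr (_ * ip f (_ * xg _ _ * _)); lia.
Qed.

Definition sub_seq (nu : seq int) (tau : seq nat) : seq int :=
  [seq x.1 - x.2%:Z | x <- zip nu tau].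

(** Passing [g_k] through [E_{b+j}] in the adjoint of [H_b] leaves [g_{k-i}] and lowers [b] by [i],
    with weight [eps t (-1) i]. Over all of [nu] the amounts [i] form a weak composition of [k]. *)
Lemma ip_H_G (nu : seq int) k f :
  ip (vseq (wt t) nu) (xg wtG k * f) =
  \sum_(tau <- weak_compositions (size nu) k)
     (\prod_(r <- tau) eps t (-1) r%:Z) * ip (vseq (wt t) (sub_seq nu tau)) f.
Proof.
have epsG := E_xg_weight (be := wtG) (a := t) (b := -1) _ _ (fun=> erefl).
elim: nu k f => [|b nu IH] k f.
  rewrite weak_compositions0 /=; case: eqVneq => [->|k0].
    by rewrite big_seq1 big_nil !mul1r xg0 mul1r.
  rewrite big_nil; have [k0'|k0'] := ltP k 0; first by rewrite xg_neg // mul0r linear0.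
  (* For empty [nu] and [k > 0]: the adjoint of multiplication by [g_k] is a coefficient of an
     exponential of derivations, and kills 1. *)
  rewrite -gexp_mulop ip_sym; pose wtG' r := wtG r / (1 - t ^+ r).
  pose dG r := wtG' r \*: d r.
  have dGC r s g : dG r (dG s g) = dG s (dG r g).
    by rewrite /dG /= !linearZ /= scalerCA d_comm.
  rewrite (@gexp_adjoint (mulop wtG) dG) //.
  - have kn : k <= `|k|%N%:Z by lia.
    suff -> : gexp (fun r => dG r) k 1 = 0 by rewrite linear0.
    apply: (scale_int_inj char0 k0); rewrite (gexp_rec char0 1 dGC kn) scaler0 big1 // => r _.
    rewrite (gexp_comm (a := fun r => dG r) (c := dG r.+1)) => [|s g]; last exact: dGC.
    rewrite {2}/dG /= d1 scaler0 (linear0 (gexp (fun r => dG r) _)) scaler0 //.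
  - exact: mulopC.
  - by move=> r f1 g1; rewrite ip_mulop /dG /= linearZ.
(* [K0] bounds the part [i] taken from [k], [M] cuts the adjoint sums of [H_b] and of all [H_{b-i}],
   and [N] exceeds every index [b + j]. *)
have [K0 kK] : exists K0 : nat, k < K0%:Z by exists `|k|.+1; lia.
have [M bM gM] : exists2 M : nat, (dg (xg wtG k * f))%:Z < b + M%:Z & (dg f + K0)%:Z < b + M%:Z.
  by exists (`|b| + K0 + dg f + dg (xg wtG k * f)).+1; lia.
have [N KN MN] : exists2 N : nat, (K0 <= N)%N & b + M%:Z < N%:Z.
  by exists (`|b| + M + K0).+1; lia.
rewrite [vseq _ _]/= (ip_vop _ bM) /=.
under eq_bigr => j _.
  rewrite (@E_xg_mul _ _ epsG _ _ _ N); last by have := ltn_ord j; lia.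
  rewrite (sum_widen (N := K0) (h := fun i : nat => eps t (-1) i%:Z *:
     (xg wtG (k - i%:Z) * expd (b + j%:Z - i%:Z) f))); first last.
  - by move=> i iK; rewrite xg_neg ?mul0r ?scaler0 //; lia.
  - by move=> i iN; rewrite xg_neg ?mul0r ?scaler0 //; lia.
  rewrite mulr_sumr linear_sum /=.
  over.
rewrite exchange_big /= (weak_compositionsS _ _ kK); apply: eq_bigr => i _.
under eq_bigr => j _.
  rewrite -scalerAr linearZ /= mulrCA IH.
  over.
rewrite -mulr_sumr exchange_big /= mulr_sumr; apply: eq_bigr => tau _.
rewrite big_cons -mulrA -mulr_sumr; congr (_ * (_ * _)).
rewrite /sub_seq [vseq _ _ in RHS]/= (@ip_vop _ _ _ M); last by have := ltn_ord i; lia.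
by apply: eq_bigr => j _; congr (ip _ (_ * expd _ _)); rewrite addrAC.
Qed.

(** The case [n = 0] of [xg_vop], since [E_j] kills 1 for [j > 0]. It permits padding an index
    sequence with zeros, from which [tau] can then be subtracted at every position. *)
Lemma vop0_1 be : vop be 0 1 = 1.
Proof.
have := @xg_vop be 0 1 (dg 1).+1 (ltnSn _).
rewrite xg0 mul1r big_ord_recl /= E0 add0r big1 ?addr0 // => i _.
by rewrite E1 ?linear0.
Qed.

Lemma vseq_pad be nu l : vseq be (nu ++ nseq l 0) = vseq be nu.
Proof.
rewrite /vseq foldr_cat; congr (foldr _ _ nu).
by elim: l => //= l ->; exact: vop0_1.
Qed.

Lemma sub_seq_padded (s r : seq nat) : (size s <= size r)%N ->
  sub_seq ([seq a%:Z | a <- s] ++ nseq (size r - size s) 0) r = padded_sub s r.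
Proof.
move=> sr; have szs : size ([seq a%:Z | a <- s] ++ nseq (size r - size s) 0) = size r.
  by rewrite size_cat size_map size_nseq subnKC.
have szr : size (sub_seq ([seq a%:Z | a <- s] ++ nseq (size r - size s) 0) r) = size r.
  by rewrite size_map size_zip szs minnn.
apply: (@eq_from_nth _ 0); first by rewrite szr size_mkseq (maxn_idPr sr).
move=> i; rewrite szr => ir; rewrite /sub_seq (nth_map (0, 0%N)) ?size_zip ?szs ?minnn //.
rewrite nth_zip //= nth_mkseq ?(maxn_idPr sr) //; congr (_ - _).
rewrite nth_cat size_map; case: ltnP => si; first by rewrite (nth_map 0%N).
by rewrite nth_nseq if_same (nth_default _ si).
Qed.

Lemma ip_recursion (n a : nat) (mu xi : seq nat) : (0 < a)%N -> (size mu <= n)%N ->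
  ip (vseqn (wt (-1)) xi) (vseqn (wt t) (a :: mu)) =
  \sum_(i < size xi) \sum_(tau <- weak_compositions n ((nth 0%N xi i)%:Z - a%:Z))
    (2 * (-1) ^+ i) * ((\prod_(r <- tau) eps t (-1) r%:Z) *
      ip (vseqn (wt (-1)) (del_nth i xi)) (vseq (wt t) (padded_sub mu tau))).
Proof.
move=> a0 mun; rewrite ip_sym.
rewrite [vseqn _ (a :: mu)]/= (@ip_H_T a (vseqn (wt t) mu) xi a0).
apply: eq_bigr => i _; rewrite -mulr_sumr; congr (_ * _).
rewrite /vseqn -(vseq_pad _ _ (n - size mu)) ip_H_G size_cat size_map size_nseq subnKC //.
apply: eq_big_seq => tau; rewrite mem_weak_compositions => /andP[/eqP st _].
rewrite -st sub_seq_padded ?st // ip_sym; congr (_ * _).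
Qed.

End Fock.

(** * The scalar product and the Hall-Littlewood basis *)

Section Monomials.
Implicit Types (m : {cmonom nat}).

Lemma divcmK m u i : u = ucm i -> m i != 0%N -> mulcm (divcm m u) u = m.
Proof.
move=> -> mi; apply/eqP/cmP => j; rewrite mulcmE divcmE ucmE subnK //.
by case: eqP => // <-; rewrite lt0n.
Qed.

Lemma mulcmK m u : divcm (mulcm m u) u = m.
Proof. by apply/eqP/cmP => j; rewrite divcmE mulcmE addnK. Qed.

Definition pmon (la : seq nat) : {cmonom nat} := foldr (fun r => mulcm (ucm r.-1)) (onecm nat) la.

Lemma pmonE la i : is_composition la -> pmon la i = count_mem i.+1 la.
Proof.
elim: la => [|r la IH] /=; first by rewrite onecmE.
move=> /andP[r0 cla]; rewrite mulcmE IH // ucmE; congr (_ + _)%N.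
by case: r r0 => // r _; rewrite eqSS.
Qed.

Lemma mon_deg_pmon la : is_composition la -> mon_deg (pmon la) = sumn la.
Proof.
elim: la => [_|r la IH] /=.
  by rewrite /mon_deg big1_seq // => i _; rewrite onecmE mul0n.
by move=> /andP[r0 cla]; rewrite mon_degM mon_degU // IH.
Qed.

Lemma pmon_inj la nu : is_partition la -> is_partition nu -> pmon la = pmon nu -> la = nu.
Proof.
move=> /andP[sl cl] /andP[sn cn] e; apply: (sorted_eq geq_trans) => //.
  by move=> x y /= xy; apply/eqP; rewrite eqn_leq andbC.
apply/allP => -[|x] _ /=; last by rewrite -!pmonE // e.
have no0 s : is_composition s -> count_mem 0%N s = 0%N.
  by move=> cs; apply/count_memPn/negP => /(allP cs).
by rewrite !no0.
Qed.

Lemma pmon_surj m : exists la, [/\ is_partition la, pmon la = m & sumn la = mon_deg m].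
Proof.
pose s := flatten [seq nseq (m i) i.+1 | i <- finsupp m].
have cs : is_composition s.
  by apply/allP => x /flatten_mapP[i _ /nseqP[-> _]].
pose la := sort geq s.
have cla : is_composition la by rewrite /is_composition all_sort.
have e : pmon la = m.
  apply/eqP/cmP => i; rewrite pmonE // count_sort /s count_flatten -map_comp sumnE big_map.
  have [ifm|ifm] := boolP (i \in finsupp m).
    rewrite (bigD1_seq i) ?fset_uniq //= count_nseq /= eqxx mul1n big1 ?addn0 // => j ji.
    by rewrite count_nseq /= eqSS (negPf ji).
  rewrite big1_seq => [|j /= jf]; first by symmetry; apply/eqP; rewrite cmE_eq0.
  rewrite count_nseq /= eqSS; case: eqP jf => // ->; by rewrite (negPf ifm).
exists la; split=> //; last by rewrite -mon_deg_pmon // e.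
by rewrite /is_partition cla andbT sort_sorted // => x y; exact: leq_total.
Qed.

End Monomials.

(** * Derivatives in a polynomial ring described by its coefficients *)

Section MonomialBasis.
Context (K : fieldType) (L : comAlgType K).
Context (mono : {cmonom nat} -> L) (cf : {cmonom nat} -> L -> K).
Context (supp : L -> seq {cmonom nat}).
Context (cfD : forall m f g, cf m (f + g) = cf m f + cf m g).
Context (cfZ : forall m c f, cf m (c *: f) = c * cf m f).
Context (mem_supp : forall f m, (m \in supp f) = (cf m f != 0)).
Context (supp_uniq : forall f, uniq (supp f)).
Context (expand : forall f, f = \sum_(m <- supp f) cf m f *: mono m).
Context (cf_mono : forall m m', cf m' (mono m) = (m == m')%:R).
Context (monoM : forall m1 m2, mono (mulcm m1 m2) = mono m1 * mono m2).
Context (mono1 : mono (onecm nat) = 1).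
Implicit Types (f g : L) (m : {cmonom nat}).

Lemma cf_ext f g : (forall m, cf m f = cf m g) -> f = g.
Proof.
move=> e; rewrite (expand f) (expand g).
under eq_bigr do rewrite e.
by apply/perm_big/uniq_perm => // m; rewrite !mem_supp e.
Qed.

Lemma cf0 m : cf m 0 = 0.
Proof. by rewrite -(scale0r 0) cfZ mul0r. Qed.

Section Derivation.
Context (d : nat -> L -> L).
Context (cf_d : forall r f m, cf m (d r f) = cf (mulcm m (ucm r.-1)) f *+ (m r.-1).+1).

Lemma d_linear r : linear (d r).
Proof.
by move=> c f g; apply: cf_ext => m; rewrite cf_d !cfD !cfZ !cf_d mulrnDl mulrnAr.
Qed.
End Derivation.

Context (d : nat -> {linear L -> L}).
Context (cf_d : forall r f m, cf m (d r f) = cf (mulcm m (ucm r.-1)) f *+ (m r.-1).+1).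

Lemma dC r s f : d r (d s f) = d s (d r f).
Proof.
apply: cf_ext => m; rewrite !cf_d !mulcmE !ucmE -!mulcmA [mulcm (ucm s.-1) _]mulcmC.
rewrite -!mulrnA; congr (_ *+ _); rewrite [s.-1 == _]eq_sym.
by case: (eqVneq r.-1 s.-1) => [->|_] //; rewrite !addn0 mulnC.
Qed.

Lemma d_mono r m : d r (mono m) = (m r.-1)%:R *: mono (divcm m (ucm r.-1)).
Proof.
set u := ucm r.-1; apply: cf_ext => k.
rewrite cf_d cfZ !cf_mono -/u.
case: (eqVneq m (mulcm k u)) => [->|ne].
  by rewrite mulcmK eqxx mulcmE ucmE eqxx addn1 mulr1.
rewrite mul0rn; case: (eqVneq (m r.-1) 0%N) => [->|mr]; first by rewrite mul0r.
case: (eqVneq (divcm m u) k) => [e|_]; last by rewrite mulr0.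
by case/eqP: ne; rewrite -e (divcmK (erefl _)).
Qed.

Lemma d_monoM r m1 m2 : d r (mono m1 * mono m2) =
  d r (mono m1) * mono m2 + mono m1 * d r (mono m2).
Proof.
rewrite -monoM !d_mono -scalerAl -scalerAr -!monoM mulcmE natrD scalerDl.
set u := ucm r.-1; congr (_ + _).
  (* The truncated division by [u] can be undone only if the exponent is positive; otherwise its
     coefficient is 0. *)
  have [->|m1r] := eqVneq (m1 r.-1) 0%N; first by rewrite !scale0r.
  congr (_ *: mono _); rewrite -{1}(divcmK (u := u) (erefl _) m1r).
  by rewrite -mulcmA [mulcm u _]mulcmC mulcmA mulcmK.
have [->|m2r] := eqVneq (m2 r.-1) 0%N; first by rewrite !scale0r.
congr (_ *: mono _); rewrite -{1}(divcmK (u := u) (erefl _) m2r).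
by rewrite mulcmA mulcmK.
Qed.

Lemma dM r f g : d r (f * g) = d r f * g + f * d r g.
Proof.
rewrite (expand f) mulr_suml !linear_sum /= !mulr_suml -big_split /=.
apply: eq_bigr => m1 _; rewrite -scalerAl !linearZ /= -!scalerAl -scalerDr; congr (_ *: _).
rewrite (expand g) mulr_sumr !linear_sum /= !mulr_sumr -big_split /=.
apply: eq_bigr => m2 _; rewrite -scalerAr !linearZ /= -!scalerAr -scalerDr; congr (_ *: _).
exact: d_monoM.
Qed.

Definition pvar (r : nat) : L := mono (ucm r.-1).

Lemma d_p r s : d r.+1 (pvar s.+1) = (r == s)%:R.
Proof.
rewrite /pvar d_mono ucmE eq_sym /=; case: eqP => [->|_]; last by rewrite scale0r.
rewrite scale1r /= (_ : divcm _ _ = onecm nat) //.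
by apply/eqP/cmP => i; rewrite divcmE subnn onecmE.
Qed.

Definition sdeg f : nat := \max_(m <- supp f) mon_deg m.

(** A monomial of the derivative, multiplied by the power sums of [tau], is a monomial of [f]. *)
Lemma foldr_d_gt_deg f tau : is_composition tau -> (sdeg f < sumn tau)%N ->
  foldr (fun r => d r) f tau = 0.
Proof.
move=> ctau ltd.
have H m : cf m (foldr (fun r => d r) f tau) != 0 -> (mon_deg m + sumn tau <= sdeg f)%N.
  elim: tau m ctau {ltd} => [|r tau IH] m /=.
    by move=> _; rewrite -mem_supp addn0 => mf; exact: leq_bigmax_seq.
  move=> /andP[r0 ctau]; rewrite cf_d => nz.
  have := IH (mulcm m (ucm r.-1)) ctau; rewrite mon_degM mon_degU // addnA; apply.
  by apply: contraNneq nz => ->; rewrite mul0rn.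
apply: cf_ext => m; rewrite cf0; apply: contraTeq ltd => /H.
by rewrite -leqNgt; apply: leq_trans; exact: leq_addl.
Qed.

(** * The scalar product on power sums *)

Context (char0 : forall n, n.+1%:R != 0 :> K).
Context (t : K) (t_wt : forall r, 1 - t ^+ r.+1 != 0).

Lemma sum_supp (V : nmodType) (G : {cmonom nat} -> V) f s : uniq s ->
  (forall m, cf m f != 0 -> m \in s) -> (forall m, cf m f = 0 -> G m = 0) ->
  \sum_(m <- supp f) G m = \sum_(m <- s) G m.
Proof.
move=> us fs G0; rewrite [RHS](bigID (mem (supp f))) /= [X in _ + X]big1 ?addr0; last first.
  by move=> m; rewrite mem_supp negbK => /eqP; exact: G0.
rewrite -[RHS]big_filter; apply/perm_big/uniq_perm; rewrite ?filter_uniq // => m.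
by rewrite mem_filter mem_supp; case: eqP => //= /eqP /fs.
Qed.

(* [z_la(t)] for the partition [la] whose power sum is the monomial [m]. *)
Definition zt (m : {cmonom nat}) : K :=
  \prod_(i <- finsupp m) ((m i)`!%:R * (i.+1%:R / (1 - t ^+ i.+1)) ^+ m i).

Lemma ztE (s : {fset nat}) m : fsubset (finsupp m) s ->
  zt m = \prod_(i <- s) ((m i)`!%:R * (i.+1%:R / (1 - t ^+ i.+1)) ^+ m i).
Proof.
move=> le; rewrite /zt (big_fset_incl _ le) // => i _.
by rewrite -cmE_neq0 negbK => /eqP ->; rewrite expr0 mulr1.
Qed.

Lemma ztM r m :
  zt (mulcm (ucm r) m) = (m r).+1%:R * (r.+1%:R / (1 - t ^+ r.+1)) * zt m.
Proof.
have s1 : fsubset (finsupp (mulcm (ucm r) m)) (fsetU [fset r]%fset (finsupp m)).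
  by rewrite (mdomD (ucm r) m) mdomU.
rewrite (ztE s1) (ztE (fsubsetUr [fset r]%fset (finsupp m))).
have rin : r \in fsetU [fset r]%fset (finsupp m) by rewrite in_fsetU in_fset1 eqxx.
rewrite (bigD1_seq r) ?fset_uniq //= [in RHS](bigD1_seq r) ?fset_uniq //= [RHS]mulrA; congr (_ * _).
  by rewrite mulcmE ucmE eqxx add1n factS natrM [_ ^+ (m r).+1]exprS mulrACA.
by apply: eq_bigr => i ir; rewrite mulcmE ucmE eq_sym (negPf ir).
Qed.

Lemma zt1 : zt (onecm nat) = 1.
Proof. by rewrite /zt big1 // => i _; rewrite onecmE expr0 mulr1. Qed.

Definition ip f g : K := \sum_(m <- supp f) cf m f * cf m g * zt m.

Lemma ip_is_linear f : linear_for *%R (ip f).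
Proof.
move=> c g h; rewrite /ip mulr_sumr -big_split /=; apply: eq_bigr => m _.
by rewrite cfD cfZ; ring.
Qed.
HB.instance Definition _ f := GRing.isLinear.Build K L K *%R (ip f) (ip_is_linear f).

Lemma ip_sym f g : ip f g = ip g f.
Proof.
pose s := undup (supp f ++ supp g).
rewrite /ip (@sum_supp _ (fun m => cf m f * cf m g * zt m) f s) ?undup_uniq //; first last.
- by move=> m ->; rewrite !mul0r.
- by move=> m; rewrite mem_undup mem_cat -mem_supp => ->.
rewrite (@sum_supp _ (fun m => cf m g * cf m f * zt m) g s) ?undup_uniq //; first last.
- by move=> m ->; rewrite !mul0r.
- by move=> m; rewrite mem_undup mem_cat -mem_supp orbC => ->.
by apply: eq_bigr => m _; rewrite [cf m f * _]mulrC.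
Qed.

Lemma ip_mono m g : ip (mono m) g = cf m g * zt m.
Proof.
rewrite /ip (@sum_supp _ (fun k => cf k (mono m) * cf k g * zt k) _ [:: m]) //.
- by rewrite big_seq1 cf_mono eqxx mul1r.
- by move=> k; rewrite cf_mono inE [m == k]eq_sym; case: (k == m); rewrite ?eqxx.
- by move=> k ->; rewrite !mul0r.
Qed.

(** On monomials, the factor [(m r).+1] by which [zt] grows is the one produced by the
    derivative. *)
Lemma ip_p r f g : ip (pvar r.+1 * f) g = (r.+1%:R / (1 - t ^+ r.+1)) * ip f (d r.+1 g).
Proof.
rewrite [LHS]ip_sym [ip f _]ip_sym (expand f) mulr_sumr !linear_sum mulr_sumr /=.
apply: eq_bigr => m _; rewrite -scalerAr !linearZ /= mulrCA; congr (_ * _).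
rewrite -monoM [LHS]ip_sym [in RHS]ip_sym !ip_mono cf_d ztM mulcmC -mulr_natl /=; ring.
Qed.

Lemma ip11 : ip 1 1 = 1.
Proof. by rewrite -mono1 ip_mono cf_mono eqxx zt1 mulr1. Qed.

(** * Homogeneous elements *)

Definition homog (k : int) f := forall m, cf m f != 0 -> (mon_deg m)%:Z = k.

Lemma homog0 k : homog k 0.
Proof. by move=> m; rewrite cf0 eqxx. Qed.

Lemma homogD k f g : homog k f -> homog k g -> homog k (f + g).
Proof.
move=> hf hg m; rewrite cfD; have [->|/hf //] := eqVneq (cf m f) 0.
by rewrite add0r; exact: hg.
Qed.

Lemma homogZ k c f : homog k f -> homog k (c *: f).
Proof. by move=> hf m; rewrite cfZ mulf_eq0 negb_or => /andP[_]; exact: hf. Qed.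

Lemma homog_sum k (I : eqType) (s : seq I) (G : I -> L) :
  (forall i, i \in s -> homog k (G i)) -> homog k (\sum_(i <- s) G i).
Proof.
move=> hG; rewrite big_seq; apply: big_ind => //; [exact: homog0 | exact: homogD].
Qed.

Lemma homog_mono m : homog (mon_deg m)%:Z (mono m).
Proof. by move=> k; rewrite cf_mono; case: (eqVneq m k) => [->|]; rewrite ?eqxx. Qed.

Lemma homog1 : homog 0 1.
Proof.
have := @homog_mono (onecm nat); rewrite mono1 /mon_deg big1_seq // => i _.
by rewrite onecmE mul0n.
Qed.

Lemma homog_p k r f : homog k f -> homog (k + r.+1%:Z) (pvar r.+1 * f).
Proof.
move=> hf; rewrite (expand f) mulr_sumr; apply: homog_sum => m.
rewrite mem_supp => /hf <-; rewrite -scalerAr; apply: homogZ.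
rewrite -monoM addrC -PoszD; have := @homog_mono (mulcm (ucm r) m).
by rewrite mon_degM (@mon_degU r.+1).
Qed.

Lemma homog_d k r f : homog k f -> homog (k - r.+1%:Z) (d r.+1 f).
Proof.
move=> hf m; rewrite cf_d => nz; apply/eqP; rewrite eq_sym subr_eq eq_sym; apply/eqP.
rewrite -PoszD -{1}(@mon_degU r.+1) // -mon_degM; apply: hf.
by apply: contraNneq nz => ->; rewrite mul0rn.
Qed.

(** The sign [e] is 1 for multiplications and -1 for derivatives. *)
Lemma homog_gexp (a : nat -> L -> L) (e : int) k j f :
  (forall r l g, homog l g -> homog (l + e * r.+1%:Z) (a r.+1 g)) ->
  homog k f -> homog (k + e * j) (gexp a j f).
Proof.
move=> ha hf; apply: homog_sum => tau; rewrite mem_compositions => /andP[ct /eqP <-].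
apply: homogZ; elim: tau ct => [_|r tau IH] /=; first by rewrite mulr0 addr0.
move=> /andP[r0 /IH h]; case: r r0 => // r _.
by rewrite PoszD mulrDr addrCA addrC; exact: ha.
Qed.

Lemma homog_vop be n k f : homog k f -> homog (k + n) (vop pvar d sdeg be n f).
Proof.
move=> hf; rewrite /vop; apply: homog_sum => j _.
have -> : k + n = k + -1 * j%:Z + 1 * (n + j%:Z) by ring.
apply: homog_gexp; first by move=> r l g hg; rewrite mul1r; apply: homogZ; exact: homog_p.
apply: homog_gexp hf => r l g hg.
by rewrite mulN1r /opd -scaleN1r; apply: homogZ; exact: homog_d.
Qed.

Lemma homog_vseq be nu : homog (\sum_(a <- nu) a) (vseq pvar d sdeg be nu).
Proof.
elim: nu => [|a nu IH]; first by rewrite big_nil; exact: homog1.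
by rewrite big_cons addrC; exact: homog_vop.
Qed.

Lemma homog_supp (V : nmodType) (G : {cmonom nat} -> V) k f : homog k f ->
  (forall m, cf m f = 0 -> G m = 0) ->
  \sum_(m <- supp f) G m = \sum_(la <- partitions k) G (pmon la).
Proof.
move=> hf G0; rewrite (@sum_supp _ G f [seq pmon la | la <- partitions k]) ?big_map //.
  rewrite map_inj_in_uniq ?uniq_partitions // => la nu.
  by rewrite !mem_partitions => /andP[pl _] /andP[pn _]; exact: pmon_inj.
move=> m /hf mk; have [la [pla em sm]] := pmon_surj m.
by apply/mapP; exists la; rewrite // mem_partitions pla sm mk eqxx.
Qed.

(** * The Hall-Littlewood basis *)

Local Notation Q := (vseqn pvar d sdeg (wt t)).

Lemma Q_orthogonal la nu : is_partition la -> is_partition nu ->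
  ip (Q la) (Q nu) = if la == nu then hlb t la else 0.
Proof. exact: (H_orthogonal char0 dM d_p dC foldr_d_gt_deg t_wt ip_sym ip_p ip11). Qed.

Lemma hlb_neq0 la : hlb t la != 0.
Proof.
elim: la => [|a la IH]; first exact: oner_neq0.
by rewrite /= eqxx add1n mulf_neq0.
Qed.

Lemma homog_vseqn be la : homog (sumn la)%:Z (vseqn pvar d sdeg be la).
Proof.
have := @homog_vseq be [seq a%:Z | a <- la].
rewrite big_map; suff -> : \sum_(j <- la) j%:Z = (sumn la)%:Z by [].
by elim: la => [|a la IH]; rewrite ?big_nil // big_cons IH.
Qed.

(* By orthogonality the transition matrix [M] from the [Q_la] to the power sums
   has a right inverse [W], hence a left inverse. *)
Lemma expand_Q k f : homog k f ->
  f = \sum_(la <- partitions k) (ip f (Q la) / hlb t la) *: Q la.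
Proof.
move=> hf; set P := partitions k; pose N := size P; pose lam i := nth [::] P i.
have Pbig (V : nmodType) (G : seq nat -> V) : \sum_(la <- P) G la = \sum_(i < N) G (lam i).
  by rewrite (big_nth [::]) big_mkord.
have lamP (i : 'I_N) : lam i \in P by exact: mem_nth.
have lam_part (i : 'I_N) : is_partition (lam i).
  by have := lamP i; rewrite mem_partitions => /andP[].
have hQ (i : 'I_N) : homog k (Q (lam i)).
  have := lamP i; rewrite mem_partitions => /andP[_ /eqP <-]; exact: homog_vseqn.
pose M := \matrix_(i < N, j < N) cf (pmon (lam j)) (Q (lam i)).
pose W := \matrix_(j < N, i < N) (zt (pmon (lam j)) * cf (pmon (lam j)) (Q (lam i)) / hlb t (lam i)).
have ipE h (i : 'I_N) : homog k h ->
    ip h (Q (lam i)) = \sum_(j < N) cf (pmon (lam j)) h * cf (pmon (lam j)) (Q (lam i)) * zt (pmon (lam j)).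
  move=> hh; rewrite /ip (homog_supp (G := fun m => cf m h * cf m (Q (lam i)) * zt m) hh) ?Pbig //.
  by move=> m ->; rewrite !mul0r.
have MW : M *m W = 1%:M.
  apply/matrixP => i i'; rewrite !mxE.
  transitivity (ip (Q (lam i)) (Q (lam i')) / hlb t (lam i')).
    rewrite ipE // mulr_suml; apply: eq_bigr => j _; rewrite !mxE; ring.
  rewrite Q_orthogonal // nth_uniq ?uniq_partitions //.
  have [->|] := eqVneq i i'; first by rewrite eqxx divff ?hlb_neq0.
  by move=> ne; rewrite -val_eqE in ne; rewrite (negPf ne) mul0r.
have WM := mulmx1C MW.
have expandP h : homog k h -> h = \sum_(j < N) cf (pmon (lam j)) h *: mono (pmon (lam j)).
  move=> hh; rewrite {1}(expand h) (homog_supp (G := fun m => cf m h *: mono m) hh) ?Pbig //.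
  by move=> m ->; rewrite scale0r.
rewrite Pbig {1}(expandP f hf).
(* By [W M = 1], the power sum with index [j] is [\sum_i W j i Q_i]. *)
transitivity (\sum_(j < N) \sum_(i < N) (cf (pmon (lam j)) f * W j i) *: Q (lam i)).
  apply: eq_bigr => j _.
  under eq_bigr => i _ do rewrite (expandP _ (hQ i)) scaler_sumr.
  rewrite exchange_big /= (bigD1 j) //= [X in _ + X]big1 ?addr0.
    under eq_bigr => i _ do rewrite scalerA -mulrA.
    rewrite -scaler_suml -mulr_sumr; congr (_ *: _).
    transitivity (cf (pmon (lam j)) f * (W *m M) j j); first by rewrite WM mxE eqxx mulr1.
    by rewrite mxE; congr (_ * _); apply: eq_bigr => i _; rewrite [M _ _]mxE.
  move=> j' jj'; under eq_bigr => i _ do rewrite scalerA -mulrA.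
  rewrite -scaler_suml -mulr_sumr.
  suff -> : \sum_(i < N) W j i * cf (pmon (lam j')) (Q (lam i)) = (W *m M) j j'.
    by rewrite WM mxE eq_sym (negPf jj') mulr0 scale0r.
  by rewrite mxE; apply: eq_bigr => i _; rewrite [M _ _]mxE.
rewrite exchange_big /=; apply: eq_bigr => i _; rewrite -scaler_suml; congr (_ *: _).
rewrite ipE // mulr_suml; apply: eq_bigr => j _; rewrite !mxE; ring.
Qed.

Local Notation T := (vseqn pvar d sdeg (wt (-1))).

Lemma expand_P k f : homog k f ->
  f = \sum_(la <- partitions k) ip f (Q la) *: ((hlb t la)^-1 *: Q la).
Proof.
by move=> hf; rewrite {1}(expand_Q hf); apply: eq_bigr => la _; rewrite scalerA.
Qed.

(** The [P_la] are dual to the [Q_la]. The claim covers any coefficient function, hence also one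
    obtained by choice. *)
Lemma coef_P k f (c : seq nat -> K) mu : mu \in partitions k ->
  f = \sum_(la <- partitions k) c la *: ((hlb t la)^-1 *: Q la) -> c mu = ip f (Q mu).
Proof.
move=> muP ->; rewrite [RHS]ip_sym linear_sum (bigD1_seq mu) ?uniq_partitions //=.
have pmu : is_partition mu by move: muP; rewrite mem_partitions => /andP[].
rewrite !linearZ /= Q_orthogonal // eqxx mulVf ?hlb_neq0 // mulr1 big1_seq ?addr0 // => la.
move=> /andP[ne]; rewrite mem_partitions => /andP[pla _].
by rewrite !linearZ /= Q_orthogonal // eq_sym (negPf ne) !mulr0.
Qed.

(** For [r > 0] the factor is [(t + 1) t^(r-1) = t^r (1 + 1/t)], and for [r = 0] it is 1. *)
Lemma prod_eps (tau : seq nat) : t != 0 ->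
  \prod_(r <- tau) eps t (-1) r%:Z = t ^+ sumn tau * (1 + t^-1) ^+ nb_nonzero tau.
Proof.
move=> t0; elim: tau => [|r tau IH]; first by rewrite big_nil mul1r.
rewrite big_cons IH /nb_nonzero /= !exprD mulrACA; congr (_ * _).
case: r => [|r] /=; first by rewrite mulr1.
by rewrite opprK expr1 exprSr -mulrA mulrDr mulr1 divff // mulrC.
Qed.

Lemma sumn_del_nth (i : nat) xi : (i < size xi)%N ->
  (sumn (del_nth i xi))%:Z = (sumn xi)%:Z - (nth 0%N xi i)%:Z.
Proof.
move=> ixi; rewrite -{2}(cat_take_drop i xi) (drop_nth 0%N ixi) /del_nth !sumn_cat /=.
by lia.
Qed.

Lemma sum_padded_sub (s r : seq nat) : (size s <= size r)%N ->
  \sum_(a <- padded_sub s r) a = (sumn s)%:Z - (sumn r)%:Z.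
Proof.
move=> sr; rewrite /padded_sub (maxn_idPr sr) big_map -{1}[size r]subn0 -/(index_iota 0 (size r)) big_mkord sumrB.
have nat_sum (u : seq nat) (l : nat) : (size u <= l)%N -> \sum_(i < l) (nth 0%N u i)%:Z = (sumn u)%:Z.
  move=> ul; rewrite (sum_widen (N := size u) (h := fun i : nat => (nth 0%N u i)%:Z)).
  - by rewrite -(big_mkord xpredT (fun i => (nth 0%N u i)%:Z)) -(big_nth 0%N xpredT (fun x : nat => x%:Z)) sumnE; elim: (u) => [|x v IH]; rewrite ?big_nil // !big_cons IH.
  - by move=> i li; rewrite nth_default // (leq_trans ul).
  - by move=> i li; rewrite nth_default.
by rewrite !nat_sum.
Qed.

(** Keeping [B] and [Ks] abstract, known only through their expansion and scalar product properties,
    hides the choice in their definitions. *)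
Lemma spin_recursion (B : seq nat -> seq int -> K) (Ks : seq nat -> seq nat -> K)
    (n : nat) (xi mu : seq nat) :
  t != 0 ->
  (forall nu, vseq pvar d sdeg (wt t) nu = \sum_(la <- partitions (\sum_(a <- nu) a)) B la nu *: Q la) ->
  (forall nu la, la \in partitions (sumn nu)%:Z -> Ks nu la = ip (T nu) (Q la)) ->
  (1 <= n)%N -> sumn xi = n -> is_partition mu -> sumn mu = n ->
  Ks xi mu =
    \sum_(i < size xi)
      \sum_(tau <- weak_compositions n ((nth 0%N xi i)%:Z - (nth 0%N mu 0)%:Z))
        \sum_(lam <- partitions (n%:Z - (nth 0%N xi i)%:Z))
          (-1) ^+ i * 2 * t ^ ((nth 0%N xi i)%:Z - (nth 0%N mu 0)%:Z)
          * (1 + t^-1) ^+ nb_nonzero tau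
          * B lam (padded_sub (behead mu) tau)
          * Ks (del_nth i xi) lam.
Proof.
move=> t0 HB HK n1 xin pmu mun.
rewrite HK; last by rewrite mem_partitions pmu xin mun eqxx.
case: mu pmu mun => [|a mu] pmu mun; first by rewrite -mun in n1.
have /andP[a0 cmu] : is_composition (a :: mu) by case/andP: pmu.
have mu_n : (size mu <= n)%N.
  by rewrite -mun /= (leq_trans (size_le_sumn cmu)) // leq_addl.
rewrite (ip_recursion char0 dM d_p dC foldr_d_gt_deg t_wt ip_sym ip_p xi a0 mu_n).
apply: eq_bigr => i _; apply: eq_big_seq => tau; rewrite mem_weak_compositions.
move=> /andP[/eqP st /eqP tk].
have mut : (size mu <= size tau)%N by rewrite st.
have sumE : \sum_(b <- padded_sub mu tau) b = n%:Z - (nth 0%N xi i)%:Z.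
  by rewrite sum_padded_sub // tk -mun /=; lia.
rewrite prod_eps // HB sumE linear_sum !mulr_sumr /=.
apply: eq_big_seq => lam lamP; rewrite linearZ /= HK; last first.
  by rewrite sumn_del_nth // xin.
(* The integer exponent of [t] is [sumn tau], hence a natural number. *)
rewrite /= -tk -exprnP; ring.
Qed.

End MonomialBasis.

(** * The ring of symmetric functions *)

(** Putting [a] in front raises its multiplicity by one, which adds exactly one factor whether or
    not [a] occurs already. *)
Lemma hlb_undup (K : fieldType) (t : K) la :
  \prod_(i <- undup la) \prod_(1 <= j < (count_mem i la).+1) (1 - t ^+ j) = hlb t la.
Proof.
pose Phi c : K := \prod_(1 <= j < c.+1) (1 - t ^+ j).
have PhiS c : Phi c.+1 = Phi c * (1 - t ^+ c.+1) by rewrite /Phi big_nat_recr.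
elim: la => [|a la IH]; first by rewrite big_nil.
rewrite /= eqxx add1n -IH -/(Phi _) mulrC.
pose G (s : seq nat) : K := \prod_(i <- undup s) Phi (count_mem i s).
rewrite -[LHS]/(G (a :: la)) -[X in _ = X * _]/(G la) /G /=.
case: ifP => ala.
  rewrite !(bigD1_seq a) ?undup_uniq ?mem_undup //= eqxx add1n PhiS.
  rewrite -!mulrA [_ * (1 - _)]mulrC; congr (_ * (_ * _)).
  by apply: eq_bigr => i ia; rewrite eq_sym (negPf ia).
rewrite big_cons eqxx add1n (count_memPn (negbT ala)) PhiS [Phi 0]/Phi big_geq // mul1r mulrC.
congr (_ * _); apply: eq_big_seq => i; rewrite mem_undup => ila.
by case: eqP ala => [->|]; rewrite ?ila.
Qed.

Lemma natF_neq0 n : n.+1%:R != 0 :> F.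
Proof.
have -> : (n.+1%:R : F) = tofrac (n.+1%:R : {poly rat}) by rewrite rmorph_nat.
by rewrite tofrac_eq0 -polyC_natr polyC_eq0 pnatr_eq0.
Qed.

Lemma one_sub_tX_neq0 j : 1 - t ^+ j.+1 != 0.
Proof.
rewrite subr_eq0 -rmorphXn -tofrac1 tofrac_eq; apply/eqP.
by move/(congr1 (fun q : {poly rat} => q`_0)); rewrite coef1 coefXn.
Qed.

Lemma t_neq0 : t != 0.
Proof. by rewrite tofrac_eq0 polyX_eq0. Qed.

Definition monL (m : {cmonom nat}) : Lam := << 1 *g m >>.
Definition cfL (m : {cmonom nat}) (f : Lam) : F := f@_m.
Definition suppL (f : Lam) : seq {cmonom nat} := msupp f.

(* [exact_no_check] leaves the conversion of [Lam] to the monoid algebra to the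
   kernel at Qed; the unifier gets lost in it. *)
Lemma cfLD m f g : cfL m (f + g) = cfL m f + cfL m g.
Proof. exact_no_check (mcoeffD m f g). Qed.

Lemma cfLZ m c f : cfL m (c *: f) = c * cfL m f.
Proof. exact_no_check (mcoeffZ c f m). Qed.

Lemma mem_suppL f m : (m \in suppL f) = (cfL m f != 0).
Proof. by rewrite /cfL mcoeff_neq0. Qed.

Lemma uniq_suppL f : uniq (suppL f).
Proof. exact: fset_uniq. Qed.

Lemma cf_monL m m' : cfL m' (monL m) = (m == m')%:R.
Proof. exact: mcoeffU. Qed.

Lemma monLM m1 m2 : monL (mulcm m1 m2) = monL m1 * monL m2.
Proof.
pose e := congr1 (fun c : F => << c *g mulcm m1 m2 >> : Lam) (mulr1 1).
exact_no_check (esym (etrans (etrans (malgM_def (monL m1) (monL m2)) (fgmulUU 1 1 m1 m2)) e)).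
Qed.

Lemma monL1 : monL (onecm nat) = 1.
Proof. by []. Qed.

Lemma expandL f : f = \sum_(m <- suppL f) cfL m f *: monL m.
Proof.
apply/malgP => k; rewrite -[RHS]/(cfL k _).
have cfL0 : cfL k 0 = 0 by exact: mcoeff0.
rewrite (big_morph (cfL k) (cfLD k) cfL0).
under eq_bigr => m _ do rewrite cfLZ cf_monL.
rewrite -[LHS]/(cfL k f).
have [kf|kf] := boolP (k \in suppL f).
  rewrite (bigD1_seq k) ?uniq_suppL //= eqxx mulr1 big1 ?addr0 // => m mk.
  by rewrite (negPf mk) mulr0.
move: (kf); rewrite mem_suppL negbK => /eqP ->; rewrite big1_seq // => m /= mf.
by case: eqP kf => [<-|]; rewrite ?mf // mulr0.
Qed.

Lemma mcoeff_pderiv r (f : Lam) m :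
  cfL m (pderiv r f) = cfL (mulcm m (ucm r.-1)) f *+ (m r.-1).+1.
Proof.
rewrite /cfL; set u := ucm r.-1; rewrite /pderiv raddf_sum /=.
(* Truncated division can send another monomial to [m], but only when its exponent is 0 and its
   coefficient vanishes. *)
have term m' : m' != mulcm m u -> (<< f@_m' *+ m' r.-1 *g divcm m' u >> : Lam)@_m = 0.
  move=> ne; rewrite mcoeffU; case: eqVneq => [e|]; last by rewrite mulr0n.
  have [->|m'r] := eqVneq (m' r.-1) 0%N; first by rewrite mulr0n mul0rn.
  by case/eqP: ne; rewrite -e (divcmK (erefl _)).
have [muf|muf] := boolP (mulcm m u \in msupp f).
  rewrite (bigD1_seq (mulcm m u)) ?fset_uniq //= big1 => [|m' /term //].
  by rewrite addr0 mcoeffU mulcmK eqxx mulcmE ucmE eqxx addn1.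
rewrite mcoeff_outdom // mul0rn big_seq big1 // => m' m'f; apply: term.
by apply: contraNneq muf => <-.
Qed.

Lemma pderiv_is_linear r : linear (pderiv r).
Proof. exact: (d_linear cfLD cfLZ mem_suppL uniq_suppL expandL mcoeff_pderiv). Qed.
HB.instance Definition _ r :=
  GRing.isLinear.Build F Lam Lam *:%R (pderiv r) (pderiv_is_linear r).

Lemma HLbE la : HLb la = hlb t la.
Proof. exact: hlb_undup. Qed.

(** * The coefficients obtained by choice *)

Lemma coefsP (b : seq nat -> Lam) k f (c : seq nat -> F) :
  f = \sum_(la <- partitions k) c la *: b la ->
  f = \sum_(la <- partitions k) coefs b k f la *: b la.
Proof.
move=> fc; apply: (epsilon_spec (inhabits (fun=> 0))
  (fun c => f = \sum_(la <- partitions k) c la *: b la)).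
by exists c.
Qed.

(* Convertible to [vertex_seq u nu]. *)
Definition vseqL (u : F) (nu : seq int) : Lam :=
  vseq (pvar monL) (fun r => pderiv r) (sdeg suppL) (wt u) nu.

(** [H_nu.1] is homogeneous of degree [|nu|], so [expand_Q] supplies the expansion that [epsilon]
    requires. For [|nu| < 0] both sides are 0. *)
Lemma vseqL_HLQ (nu : seq int) : vseqL t nu =
  \sum_(la <- partitions (\sum_(a <- nu) a)) straight_coef la nu *: vseqL t [seq a%:Z | a <- la].
Proof.
have hom := homog_vseq cfLD cfLZ mem_suppL expandL cf_monL monLM monL1 mcoeff_pderiv
  (be := wt t) (nu := nu).
have ex := expand_Q cfLD cfLZ mem_suppL uniq_suppL expandL cf_monL monLM monL1 mcoeff_pderiv
  natF_neq0 one_sub_tX_neq0 hom.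
exact_no_check (coefsP (b := HLQ) ex).
Qed.

(** [expand_P] shows that the chosen coefficients do expand Schur's function, and duality then
    determines them. *)
Lemma spin_kostka_ip (nu la : seq nat) : la \in partitions (sumn nu)%:Z ->
  spin_kostka nu la =
  ip cfL suppL t (vseqL (-1) [seq a%:Z | a <- nu]) (vseqL t [seq a%:Z | a <- la]).
Proof.
move=> laP.
pose V ka := vseqL t [seq a%:Z | a <- ka].
pose f := vseqL (-1) [seq a%:Z | a <- nu].
have HP ka : HLP ka = (hlb t ka)^-1 *: V ka by rewrite /HLP HLbE.
have to_HLP (c : seq nat -> F) : \sum_(ka <- partitions (sumn nu)) c ka *: HLP ka =
    \sum_(ka <- partitions (sumn nu)) c ka *: ((hlb t ka)^-1 *: V ka).
  by apply: eq_bigr => ka _; rewrite HP.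
have hom := homog_vseqn cfLD cfLZ mem_suppL expandL cf_monL monLM monL1 mcoeff_pderiv
  (be := wt (-1)) (la := nu).
have ex := expand_P cfLD cfLZ mem_suppL uniq_suppL expandL cf_monL monLM monL1 mcoeff_pderiv
  natF_neq0 one_sub_tX_neq0 hom.
have exP := coefsP (etrans ex (esym (to_HLP (fun ka => ip cfL suppL t f (V ka))))).
exact: (coef_P cfLD cfLZ mem_suppL uniq_suppL expandL cf_monL monLM monL1 mcoeff_pderiv
  natF_neq0 one_sub_tX_neq0 laP (etrans exP (to_HLP _))).
Qed.

Theorem theorem3p5 (n : nat) (xi mu : seq nat)
  (n_ge1 : (1 <= n)%N)
  (xi_strict : is_strict_partition xi) (xi_sum : sumn xi = n)
  (mu_part : is_partition mu) (mu_sum : sumn mu = n) :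
  spin_kostka xi mu =
    \sum_(i < size xi)
      \sum_(tau <- weak_compositions n ((nth 0%N xi i)%:Z - (nth 0%N mu 0)%:Z))
        \sum_(lam <- partitions (n%:Z - (nth 0%N xi i)%:Z))
          (-1) ^+ i * 2 * t ^ ((nth 0%N xi i)%:Z - (nth 0%N mu 0)%:Z)
          * (1 + t^-1) ^+ nb_nonzero tau
          * straight_coef lam (padded_sub (behead mu) tau)
          * spin_kostka (del_nth i xi) lam.
Proof.
exact: (spin_recursion cfLD cfLZ mem_suppL uniq_suppL expandL cf_monL monLM monL1 mcoeff_pderiv
  natF_neq0 one_sub_tX_neq0 t_neq0 vseqL_HLQ spin_kostka_ip n_ge1 xi_sum mu_part mu_sum).
Qed.
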